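(* Let $F:\mathbb{R}^n\rightrightarrows\mathbb{R}^n$ be upper semicontinuous with $F(x)$ compact and convex for every $x\in\mathbb{R}^n$, and suppose the system $\dot x\in F(x)$ is backward complete. Let $X_o,X_u\subset\mathbb{R}^n$ with $X_o$ closed and $X_o\cap X_u=\emptyset$. Then the system $\dot x\in F(x)$ is safe with respect to $(X_o,X_u)$ if and only if there exists a lower semicontinuous time-varying barrier function candidate $B:\mathbb{R}_{\geq0}\times\mathbb{R}^n\to\mathbb{R}$ for safety with respect to $(X_o,X_u)$, with $t\mapsto B(t,x)$ continuous for each $x\in\mathbb{R}^n$, that satisfies property $(\star\star)$.
   Context: A solution of $\dot x\in F(x)$ starting from $x_o$ is a locally absolutely continuous function $\phi:\operatorname{dom}\phi\to\mathbb{R}^n$, where $\operatorname{dom}\phi$ is $[0,T]$ or $[0,T)$ for some $T\in[0,\infty]$, with $\phi(0)=x_o$ and $\dot\phi(t)\in F(\phi(t))$ for almost all $t\in\operatorname{dom}\phi$. A solution is maximal if it cannot be extended to a solution with strictly larger domain; a system is forward complete if every maximal solution has unbounded domain. The system $\dot x\in F(x)$ is backward complete if the system $\dot x\in -F(x)$ is forward complete. The system is safe with respect to $(X_o,X_u)$ if every solution $\phi$ starting from any $x_o\in X_o$ satisfies $\phi(t)\notin X_u$ for all $t\in\operatorname{dom}\phi$. A time-varying barrier function candidate for safety with respect to $(X_o,X_u)$ is a function $B:\mathbb{R}_{\geq0}\times\mathbb{R}^n\to\mathbb{R}$ with $B(t,x)>0$ for all $(t,x)\in\mathbb{R}_{\geq0}\times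 X_u$ and $B(t,x)\le 0$ for all $(t,x)\in\mathbb{R}_{\geq0}\times X_o$. Let $K:=\{(t,x)\in\mathbb{R}_{\geq0}\times\mathbb{R}^n: B(t,x)\le 0\}$, with interior $\operatorname{int}(K)$ taken in $\mathbb{R}_{\geq0}\times\mathbb{R}^n$. Property $(\star\star)$: there is an open neighborhood $U(K)$ of $K$ such that, along each solution of $\dot x\in F(x)$ considered in the extended time–state space (i.e., along each solution of $(\dot t,\dot x)\in\{1\}\times F(x)$) starting from a point of $U(K)\setminus\operatorname{int}(K)$ and remaining in $U(K)\setminus\operatorname{int}(K)$ on a time interval, the map $t\mapsto B(t,\phi(t))$ is nonincreasing on that interval. A set-valued map $F$ is upper semicontinuous if for each $x$ and $\epsilon>0$ there is a neighborhood $U$ of $x$ with $F(y)\subset F(x)+\epsilon\mathbb{B}$ for all $y\in U$, $\mathbb{B}$ the closed unit ball. *)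

(* Defs.v *)
From HB Require Import structures.
From mathcomp Require Import all_boot all_order all_algebra.
From mathcomp Require Import all_classical all_reals all_analysis.
Set Implicit Arguments. Unset Strict Implicit. Unset Printing Implicit Defensive.
Import Order.TTheory GRing.Theory Num.Theory.
Import numFieldNormedType.Exports.
Local Open Scope classical_set_scope.
Local Open Scope ring_scope.

Section Defs.
Variables (R : realType) (n : nat).
Local Notation V := 'rV[R]_n.

(* Admissible domains of solutions: [0,T] (T >= 0), [0,T) (T > 0, so that 0
   belongs to the domain), or [0,+oo). *)
Definition sol_domain (D : set R) : Prop :=
  D = [set` `[0, +oo[] \/
  exists T : R, (0 <= T /\ D = [set` `[0, T]]) \/ (0 < T /\ D = [set` `[0, T[]).

Definition abs_cont_on (phi : R -> V) (a b : R) : Prop :=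
  forall eps : R, 0 < eps -> exists2 delta : R, 0 < delta &
    forall (k : nat) (x y : 'I_k -> R),
      (forall i, a <= x i /\ x i <= y i /\ y i <= b) ->
      (forall i j, i != j -> y i <= x j \/ y j <= x i) ->
      \sum_(i < k) (y i - x i) < delta ->
      \sum_(i < k) `|phi (y i) - phi (x i)| < eps.

Definition loc_abs_cont (D : set R) (phi : R -> V) : Prop :=
  forall a b, D a -> D b -> a <= b -> abs_cont_on phi a b.

Definition is_solution (F : V -> set V) (xo : V) (D : set R) (phi : R -> V)
  : Prop :=
  [/\ sol_domain D, phi 0 = xo, loc_abs_cont D phi &
      {ae (@lebesgue_measure R), forall t, D t ->
         derivable phi t 1 /\ F (phi t) ('D_1 phi t)}].

Definition maximal_solution (F : V -> set V) (xo : V) (D : set R)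
  (phi : R -> V) : Prop :=
  is_solution F xo D phi /\
  ~ (exists (D' : set R) (psi : R -> V),
        [/\ is_solution F xo D' psi, D `<` D' & forall t, D t -> psi t = phi t]).

Definition forward_complete (F : V -> set V) : Prop :=
  forall xo D phi, maximal_solution F xo D phi ->
    ~ (exists M : R, forall t, D t -> t <= M).

Definition neg_field (F : V -> set V) : V -> set V :=
  fun x => [set v | F x (- v)].

Definition backward_complete (F : V -> set V) : Prop :=
  forward_complete (neg_field F).

Definition safe (F : V -> set V) (Xo Xu : set V) : Prop :=
  forall xo D phi, Xo xo -> is_solution F xo D phi ->
    forall t, D t -> ~ Xu (phi t).

Definition usc_setvalued (F : V -> set V) : Prop :=
  forall (x : V) (eps : R), 0 < eps ->
    \forall y \near x, forall v, F y v -> exists2 w, F x w & `|v - w| <= eps.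

Definition Hplus : set (R * V) := [set p | 0 <= p.1].

Definition rel_interior (A : set (R * V)) : set (R * V) :=
  [set p | Hplus p /\ exists O : set (R * V), [/\ open O, O p & O `&` Hplus `<=` A]].

Definition rel_open (U : set (R * V)) : Prop :=
  exists O : set (R * V), open O /\ U = O `&` Hplus.

Definition barrier_candidate (Xo Xu : set V) (B : R * V -> R) : Prop :=
  (forall t x, 0 <= t -> Xu x -> 0 < B (t, x)) /\
  (forall t x, 0 <= t -> Xo x -> B (t, x) <= 0).

Definition lsc_on_Hplus (B : R * V -> R) : Prop :=
  forall p, Hplus p -> forall a : R, a < B p ->
    exists O : set (R * V), [/\ open O, O p &
      forall q, O q -> Hplus q -> a < B q].

Definition sublevel0 (B : R * V -> R) : set (R * V) :=
  [set p | Hplus p /\ B p <= 0].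

Definition prop_star_star (F : V -> set V) (B : R * V -> R) : Prop :=
  let K := sublevel0 B in
  exists U : set (R * V), [/\ rel_open U, K `<=` U &
    forall (t0 : R) (x0 : V) (D : set R) (phi : R -> V),
      0 <= t0 -> is_solution F x0 D phi ->
      forall S, D S ->
      (forall s, 0 <= s <= S -> (U `\` rel_interior K) (t0 + s, phi s)) ->
      forall s1 s2, 0 <= s1 -> s1 <= s2 -> s2 <= S ->
        B (t0 + s2, phi s2) <= B (t0 + s1, phi s1)].

End Defs.

(* Main.v *)
Require Import Defs.
From HB Require Import structures.
From mathcomp Require Import all_boot all_order all_algebra.
From mathcomp Require Import all_classical all_reals all_analysis.
From mathcomp Require Import measurable_realfun ring lra.
Set Implicit Arguments. Unset Strict Implicit. Unset Printing Implicit Defensive.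
Import Order.TTheory GRing.Theory Num.Theory.
Import numFieldNormedType.Exports.
Local Open Scope classical_set_scope.
Local Open Scope ring_scope.

(** Suppose the system is safe and let [B (t, x)] be the infimum of [|psi s - z|]
    over the solutions [psi] of the reversed inclusion starting from [x], the times
    [s] in [[0, t]] and the points [z] of [Xo]. Running backward along a forward
    solution and then along [psi] is again a backward solution, so [B] is
    nonincreasing along every forward solution, on all of the time-state space.
    Lower semicontinuity and the attainment of the infimum (hence positivity on
    [Xu]) both come from one compactness statement: an ultralimit of solutions
    whose initial points converge is a solution. Completeness enters there twice,
    to extend solutions to all times and to exclude blow-up of the sequence in
    finite time. Conversely, a solution leaving the closed set [K] does so at a
    last time in [K], just after which it runs in [U(K)] outside [int(K)], where
    [B] cannot become positive. *)

(** * Null sets and almost everywhere differentiability *)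

Section null_sets.
Context {R : realType}.
Notation mu := (@lebesgue_measure R).

Lemma ae_imp (P Q : R -> Prop) : (forall t, P t -> Q t) ->
  {ae mu, forall t, P t} -> {ae mu, forall t, Q t}.
Proof. exact: (@filterS _ _ (ae_filter_ringOfSetsType mu)). Qed.

Lemma ae_and (P Q : R -> Prop) : {ae mu, forall t, P t} ->
  {ae mu, forall t, Q t} -> {ae mu, forall t, P t /\ Q t}.
Proof. exact: (@filterI _ _ (ae_filter_ringOfSetsType mu)). Qed.

Lemma negligible_open_cover (N : set R) (e : R) : 0 < e -> mu.-negligible N ->
  exists O : set R, [/\ open O, N `<=` O & (mu O < e%:E)%E].
Proof.
move=> e0 [A [mA A0 NA]].
have Afin : (mu A < +oo)%E by rewrite A0 ltry.
have [U [oU AU muU]] := lebesgue_regularity_outer mA Afin e0.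
exists U; split=> //; first exact: subset_trans AU.
have mU : measurable U by exact: open_measurable.
have -> : U = A `|` (U `\` A) by rewrite setDUK.
have := @measureU2 _ _ _ mu A (U `\` A) mA (measurableD mU mA).
by move/le_lt_trans; apply; rewrite [X in (X + _)%E](_ : _ = 0%E) ?add0e.
Qed.

(** The pushforward of [mu] under [f] gives half-open intervals their length, so uniqueness of
    Lebesgue measure applies. This serves for translations and reflections of time. *)
Lemma lebesgue_measure_preimage (f : R -> R) : measurable_fun [set: R] f ->
  (forall a b, a < b -> mu (f @^-1` `]a, b]) = (b - a)%:E) ->
  forall A, measurable A -> mu (f @^-1` A) = mu A.
Proof.
move=> mf fE A mA; apply/esym.
refine (@lebesgue_measure_unique R
  (pushforward mu (f : measurableTypeR R -> measurableTypeR R)) _ A mA) => //.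
move=> _ /ocitvP[->|[[a b]/= ab ->]]; rewrite /= /pushforward.
  by rewrite preimage_set0 !measure0.
by rewrite fE// lebesgue_measure_itv/= lte_fin ab.
Unshelve. exact: mf. Qed.

Lemma ae_preimage (f : R -> R) (P : R -> Prop) : measurable_fun [set: R] f ->
  (forall a b, a < b -> mu (f @^-1` `]a, b]) = (b - a)%:E) ->
  {ae mu, forall t, P t} -> {ae mu, forall t, P (f t)}.
Proof.
move=> mf fE [A [mA A0 PA]]; exists (f @^-1` A); split.
- by rewrite -[X in measurable X]setTI; exact: mf.
- by rewrite lebesgue_measure_preimage.
- by move=> t /= /PA.
Qed.

Lemma ae_shift (c : R) (P : R -> Prop) :
  {ae mu, forall t, P t} -> {ae mu, forall t, P (c + t)}.
Proof.
apply: ae_preimage => [|a b ab].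
  by apply: measurable_funD => //; exact: measurable_cst.
rewrite (_ : _ @^-1` _ = `]a - c, b - c]%classic); last first.
  by apply/seteqP; split=> x /=; rewrite !in_itv/= ltrBlDl lerBrDl.
by rewrite lebesgue_measure_itv/= lte_fin ltrD2r ab -EFinD opprB addrA subrK.
Qed.

Lemma ae_reflect (c : R) (P : R -> Prop) :
  {ae mu, forall t, P t} -> {ae mu, forall t, P (c - t)}.
Proof.
apply: ae_preimage => [|a b ab].
  by apply: measurable_funB => //; exact: measurable_cst.
rewrite (_ : _ @^-1` _ = `[c - b, c - a[%classic); last first.
  apply/seteqP; split=> x /=; rewrite !in_itv/= => /andP[h1 h2];
  by apply/andP; split; lra.
rewrite lebesgue_measure_itv/= lte_fin ler_ltB//; congr (_%:E); lra.
Qed.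

Lemma ae_neq (c : R) : {ae mu, forall t, t != c}.
Proof.
exists [set c]; split => //; first exact: lebesgue_measure_set1.
by move=> t /= /negP; rewrite negbK => /eqP.
Qed.

End null_sets.

(** * Differentiability of Lipschitz functions almost everywhere *)

Section lipschitz_derivable.
Context {R : realType}.
Notation mu := (@lebesgue_measure R).

Section nondecreasing_lipschitz.
Variables (g : R -> R) (L : R).
Hypothesis L0 : 0 < L.
Hypothesis g_nd : {homo g : x y / x <= y}.
Hypothesis g_lip : forall x y, x <= y -> g y - g x <= L * (y - x).

Let g_rc : right_continuous g.
Proof.
apply/right_continuousW => x; apply/cvgrPdist_lt => e e0; near=> y.
have xy : `|x - y| < e / L by near: y; apply: cvgr_dist_lt; rewrite ?divr_gt0.
move: xy; rewrite ltr_pdivlMr//; apply: le_lt_trans.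
have [xy|/ltW yx] := leP x y.
  by rewrite !ler0_norm ?subr_le0 ?g_nd// !opprB mulrC g_lip.
by rewrite !ger0_norm ?subr_ge0 ?g_nd// mulrC g_lip.
Unshelve. all: by end_near. Qed.

HB.instance Definition _ := isCumulative.Build R _ R g g_nd g_rc.

Let nu : {measure set (measurableTypeR R) -> \bar R} :=
  lebesgue_stieltjes_measure g.

Let nuE a b : a <= b -> nu `]a, b]%classic = (g b - g a)%:E.
Proof.
move=> ab; rewrite /nu/= /lebesgue_stieltjes_measure.
rewrite /measure_extension measurable_mu_extE/=; last exact: is_ocitv.
by rewrite wlength_itv_bnd.
Qed.

(** A null set has covers by half-open intervals of total length below [e / L]; by the Lipschitz
    bound their total [g]-length is at most [e]. *)
Let nu_dom A : measurable A -> mu A = 0%E -> nu A = 0%E.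
Proof.
move=> mA A0; apply/eqP; rewrite eq_le measure_ge0 andbT.
apply/lee_addgt0Pr => e e0; rewrite add0e.
have : (mu A < (e / L)%:E)%E by rewrite A0 lte_fin divr_gt0.
rewrite /lebesgue_measure /lebesgue_stieltjes_measure /measure_extension.
move=> /ereal_inf_lt[_ [F [mF AF] <-]] Fe.
have gF k : (wlength g (F k) <= L%:E * wlength idfun (F k))%E.
  have /ocitvP[->|[[x y]/= xy ->]] := mF k.
    by rewrite !wlength0 mule0.
  by rewrite !wlength_itv_bnd ?(ltW xy)// -EFinM lee_fin g_lip// ltW.
have /le_trans : (nu A <= \sum_(k <oo) wlength g (F k))%E.
  by apply: ereal_inf_lbound; exists F.
apply; apply: (@le_trans _ _ (\sum_(k <oo) (L%:E * wlength idfun (F k)))%E).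
  by apply: lee_nneseries => // k _; exact: wlength_ge0.
rewrite nneseriesZl//.
have -> : e = L * (e / L) by rewrite mulrC divfK// gt_eqF.
by rewrite EFinM lee_pmul2l// ltW.
Qed.

(* The Stieltjes measure of [g] has a Radon-Nikodym density [h], so [g] is an
   indefinite integral of [h] and Lebesgue differentiation applies. *)
Lemma nd_lipschitz_ae_derivable (a b : R) : a < b ->
  {ae mu, forall t, a < t < b -> derivable g t 1}.
Proof.
move=> ab.
have mD : measurable (`]a, b]%classic : set (measurableTypeR R)).
  exact: measurable_itv.
have nuD : (nu `]a, b]%classic < +oo)%E by rewrite nuE ?ltW// ltry.
(* Restricting [nu] to []a, b]] makes it finite, as the Radon-Nikodym theorem requires. *)
have dom : mfrestr mD nuD `<< mu.
  apply/null_content_dominatesP => A mA A0; rewrite /mfrestr /mrestr.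
  apply: nu_dom; first exact: measurableI.
  by apply/eqP; rewrite -measure_le0 -A0 le_measure// inE//; exact: measurableI.
have [h [h0 hfin hint hE]] := radon_nikodym_sigma_finite dom.
pose f := fine \o h.
have hf : h = EFin \o f by apply/funext => x; rewrite /f/= fineK.
rewrite hf in hint.
have intf A : measurable A -> mu.-integrable A (EFin \o f).
  by move=> mA; apply: integrableS hint.
(* With the bound [BRight a] the primitive integrates over []a, y]], whose [nu]-measure is exactly
   [g y - g a]. *)
have := @FTC1 R f (BRight a).
move=> /(_ (fun y => intf _ (measurable_itv _))).
move=> /(_ (open_integrable_locally openT (intf _ measurableT))) /=.
apply: ae_imp => t tF /andP[at_ tb].
have [|dF _] := tF; first exact: at_.
have FE y : a < y < b -> (\int[mu]_(x in `]a, y]) f x)%R = g y - g a.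
  move=> /andP[ay yb]; rewrite /Rintegral -[X in integral _ _ X]hf.
  have <- : nu (`]a, y] `&` `]a, b])%classic = (\int[mu]_(x in `]a, y]) h x)%E.
    by apply: hE; exact: measurable_itv.
  rewrite [X in nu X](_ : _ = `]a, y]%classic) ?nuE ?ltW//.
  apply/seteqP; split => [x []//|x]; rewrite /= !in_itv/= => /andP[ax xy].
  by rewrite ax xy (le_trans xy (ltW yb)).
have -> : g = (fun y => (g y - g a) + g a) by apply/funext => y; rewrite subrK.
apply: derivableD; last exact: derivable_cst.
apply: near_eq_derivable dF.
near=> y; rewrite FE//; apply/andP; split; near: y.
- exact: lt_nbhsr.
- exact: lt_nbhsl.
Unshelve. all: by end_near. Qed.

End nondecreasing_lipschitz.

(** Composing with the clamp [c] onto [[a, b]] and adding slope [L + 1] yields a nondecreasing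
    Lipschitz function on the whole line; inside the interval, subtracting the linear term gives [f]
    back. The extra [1] keeps the Lipschitz constant positive when [L = 0]. *)
Lemma lipschitz_ae_derivable (f : R -> R) (L a b : R) :
  (forall x y, a <= x -> x <= y -> y <= b -> `|f y - f x| <= L * (y - x)) ->
  {ae mu, forall t, a < t < b -> derivable f t 1}.
Proof.
move=> f_lip; have [ab|ba] := ltP a b; last first.
  by apply: aeW => t /andP[a_t t_b]; have := lt_trans a_t t_b; rewrite ltNge ba.
have L0 : 0 <= L.
  rewrite -(@pmulr_lge0 _ (b - a)) ?subr_gt0//.
  by rewrite (le_trans _ (f_lip a b _ _ _))// ltW.
pose c (x : R) := Num.max a (Num.min x b).
have c_ge x : a <= c x by rewrite le_max lexx.
have c_le x : c x <= b by rewrite ge_max (ltW ab) ge_min lexx orbT.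
have c_nd : {homo c : x y / x <= y}.
  by move=> x y xy; rewrite /c le_max2// le_min2.
have c_lip x y : x <= y -> c y - c x <= y - x.
  by move=> xy; rewrite /c; have := c_nd _ _ xy; rewrite /c;
    case: (leP x b) => ?; case: (leP y b) => ?; rewrite ?(min_l, min_r)//;
    case: (leP a x) => ?; case: (leP a y) => ?; case: (leP a b) => ? ?; lra.
have c_id x : a < x < b -> c x = x.
  by move=> /andP[ax xb]; rewrite /c min_l ?ltW// max_r// ltW.
pose g x := f (c x) + (L + 1) * c x.
have f_lipc x y : x <= y -> `|f (c y) - f (c x)| <= L * (c y - c x).
  by move=> xy; apply: f_lip => //; exact: c_nd.
have g_nd : {homo g : x y / x <= y}.
  move=> x y xy; rewrite -subr_ge0 /g; have := f_lipc _ _ xy.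
  rewrite ler_norml => /andP[h _]; have := c_nd _ _ xy; nra.
have g_lip x y : x <= y -> g y - g x <= (L + L + 1) * (y - x).
  move=> xy; rewrite /g; have := f_lipc _ _ xy.
  rewrite ler_norml => /andP[_ h]; have := c_lip _ _ xy.
  have := c_nd _ _ xy; nra.
have L1 : 0 < L + L + 1 by lra.
apply: ae_imp (nd_lipschitz_ae_derivable L1 g_nd g_lip ab) => t + tab.
move=> /(_ tab) dg.
have : derivable (fun x => g x - (L + 1) * x) t 1.
  by apply: derivableB.
apply: near_eq_derivable.
near=> x; rewrite /g c_id ?addrK//; near: x.
by case/andP: tab => a_t t_b; near=> x; apply/andP; split; near: x;
  [exact: lt_nbhsr|exact: lt_nbhsl].
Unshelve. all: by end_near. Qed.

Lemma lipschitz_ae_derivable_rV n (f : R -> 'rV[R]_n) (L a b : R) :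
  (forall x y, a <= x -> x <= y -> y <= b -> `|f y - f x| <= L * (y - x)) ->
  {ae mu, forall t, a < t < b -> derivable f t 1}.
Proof.
move=> f_lip.
have : {ae mu, forall t, forall j, a < t < b -> derivable (fun x => f x ord0 j) t 1}.
  apply: (@filter_forall _ _ _ _ (ae_filter_ringOfSetsType mu)) => j.
  apply: (@lipschitz_ae_derivable _ L) => x y ax xy yb.
  apply: le_trans (f_lip _ _ ax xy yb).
  rewrite [leRHS]/Num.Def.normr/= mx_normrE.
  apply: le_trans; last exact: (le_bigmax _ _ (ord0, j)).
  by rewrite !mxE.
apply: ae_imp => t td tab; apply/derivable_mxP => i j.
by rewrite (ord1 i); exact: td.
Qed.

End lipschitz_derivable.

(** * Mean value inclusion *)

Section continuous_induction.
Context {R : realType}.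

(** Take the step at the supremum of the good points: a good point just to its left passes the
    property to points on its right, which is contradictory unless the supremum is [b]. Since the
    step jumps across [t], [E] need not be closed. *)
Lemma continuous_induction (a b : R) (E : set R) : a <= b -> E a ->
  (forall t : R, a <= t <= b -> exists2 d : R, 0 < d & forall u v : R, E u -> a <= u ->
    t - d < u -> u <= t -> t <= v -> v < t + d -> v <= b -> E v) -> E b.
Proof.
move=> ab Ea step; pose S := [set t | E t /\ a <= t <= b].
have supS : has_sup S.
  by split; [exists a; split => //; rewrite lexx|exists b => t [_ /andP[]]].
have aS : a <= sup S by apply: ub_le_sup; [case: supS|split=> //; rewrite lexx].
have Sb : sup S <= b by apply: sup_le_ub; [case: supS|move=> t [_ /andP[]]].
have [|d d0 dE] := step (sup S); first by rewrite aS.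
have [u [Eu /andP[au ub]] Su] := sup_adherent d0 supS.
have uS : u <= sup S.
  by apply: ub_le_sup; [case: supS|split=> //; rewrite au].
pose v := Num.min b (sup S + d / 2).
have vb : v <= b by rewrite ge_min lexx.
have Sv : sup S <= v by rewrite le_min Sb lerDl divr_ge0// ltW.
have vd : v < sup S + d by rewrite gt_min ltrD2l ltr_pdivrMr// ltr_pMr// ltr1n orbT.
have Ev : E v by exact: (dE u v).
have : v <= sup S.
  apply: ub_le_sup; first by case: supS.
  by split=> //; rewrite vb (le_trans au)// (le_trans uS).
rewrite ge_min => /orP[bS|]; last by rewrite gerDl leNgt divr_gt0.
by have -> : b = v by apply/eqP; rewrite eq_le vb (le_trans bS Sv).
Qed.

End continuous_induction.

Section mean_value.
Context {R : realType} {n : nat}.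
Notation V := 'rV[R]_n.
Notation mu := (@lebesgue_measure R).
Implicit Types (phi : R -> V) (a b t : R).

Lemma derivable_approx phi t (e : R) : derivable phi t 1 -> 0 < e ->
  exists2 d : R, 0 < d & forall h, `|h| < d ->
    `|phi (t + h) - phi t - h *: 'D_1 phi t| <= e * `|h|.
Proof.
move=> dphi e0; have /cvgrPdist_le/(_ _ e0)[d /= d0 dP] := dphi.
exists d => // h hd; have [->|h0] := eqVneq h 0.
  by rewrite addr0 subrr scale0r subr0 !normr0 mulr0.
have := dP h; rewrite /= sub0r normrN => /(_ hd h0).
rewrite (_ : h *: 1 = h); last by rewrite /GRing.scale/= mulr1.
rewrite -/('D_1 phi t) -(ler_pM2r (_ : 0 < `|h|)) ?normr_gt0//.
apply: le_trans; rewrite distrC mulrC -normrZ scalerBr scalerA mulfV// scale1r.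
by rewrite (addrC h t).
Qed.

(** Since [t] separates [u] from [v], the first-order errors at the two ends add up to a multiple of
    [v - u]. *)
Lemma derivable_straddle phi t (e : R) : derivable phi t 1 -> 0 < e ->
  exists2 d : R, 0 < d & forall u v : R, t - d < u -> u <= t -> t <= v -> v < t + d ->
    `|phi v - phi u - (v - u) *: 'D_1 phi t| <= e * (v - u).
Proof.
move=> dphi e0; have [d d0 dP] := derivable_approx dphi e0.
exists d => // u v tu ut tv vt.
have hv : `|v - t| = v - t by rewrite ger0_norm// subr_ge0.
have hu : `|u - t| = t - u by rewrite distrC ger0_norm// subr_ge0.
have := dP (v - t); rewrite hv => /(_ ltac:(lra)).
have := dP (u - t); rewrite hu => /(_ ltac:(lra)).
rewrite ![t + (_ - _)]addrC !subrK => Hu Hv.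
have -> : e * (v - u) = e * (v - t) + e * (t - u) by ring.
have -> : phi v - phi u - (v - u) *: 'D_1 phi t =
  (phi v - phi t - (v - t) *: 'D_1 phi t) - (phi u - phi t - (u - t) *: 'D_1 phi t).
  by apply/matrixP => i j; rewrite !mxE; ring.
by rewrite (le_trans (ler_normB _ _))// lerD.
Qed.

Lemma abs_cont_unif phi a b (e : R) : abs_cont_on phi a b -> 0 < e ->
  exists2 d : R, 0 < d & forall x y : R, a <= x -> x <= y -> y <= b -> y - x < d ->
    `|phi y - phi x| < e.
Proof.
move=> ac /ac[d d0 dP]; exists d => // x y ax xy yb xyd.
have := dP 1%N (fun=> x) (fun=> y); rewrite !big_ord1; apply => // i j.
by rewrite (ord1 i) (ord1 j).
Qed.

Lemma abs_cont_sub phi a b c d : a <= c -> d <= b ->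
  abs_cont_on phi a b -> abs_cont_on phi c d.
Proof.
move=> ac db acphi e /acphi[r r0 rP]; exists r => // k x y xy; apply: rP => i.
by have [h1 [h2 h3]] := xy i; rewrite (le_trans ac h1) h2 (le_trans h3 db).
Qed.

Lemma lipschitz_abs_cont phi a b (L : R) :
  (forall x y, a <= x -> x <= y -> y <= b -> `|phi y - phi x| <= L * (y - x)) ->
  abs_cont_on phi a b.
Proof.
move=> lip e e0; have L1 : 0 < `|L| + 1 by rewrite ltr_wpDl.
exists (e / (`|L| + 1)); first by rewrite divr_gt0.
move=> k x y xy _; rewrite ltr_pdivlMr//; apply: le_lt_trans.
rewrite mulr_suml; apply: ler_sum => i _; have [h1 [h2 h3]] := xy i.
apply: (le_trans (lip _ _ h1 h2 h3)); rewrite mulrC ler_wpM2l ?subr_ge0//.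
by rewrite (le_trans (ler_norm _))// lerDl.
Qed.

(* The intervals of a chain are listed from right to left. *)
Fixpoint chain_in (O : set R) a t (s : seq (R * R)) : Prop :=
  if s is p :: s' then
    [/\ p.1 <= p.2, p.2 <= t, `[p.1, p.2] `<=` O & chain_in O a p.1 s']
  else a <= t.

Lemma chain_in_le O a t s : chain_in O a t s -> a <= t.
Proof.
elim: s t => //= p s IH t [h1 h2 _ /IH h3].
by rewrite (le_trans h3)// (le_trans h1).
Qed.

Lemma chain_in_widen O a t t' s : t <= t' -> chain_in O a t s -> chain_in O a t' s.
Proof.
by case: s => [|p s] /= tt'; [move/le_trans; apply|
  move=> [h1 h2 h3 h4]; split=> //; exact: le_trans tt'].
Qed.

(** Dropping right endpoints makes the intervals disjoint subsets of [O] without changing their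
    lengths. *)
Lemma chain_in_measure O a t s : open O -> chain_in O a t s ->
  ((\sum_(p <- s) (p.2 - p.1))%:E <= mu (O `&` `[a, t[))%E.
Proof.
move=> oO; have mI x y : measurable (O `&` `[x, y[).
  by apply: measurableI; [exact: open_measurable|exact: measurable_itv].
elim: s t => [|p s IH] t /=; first by rewrite big_nil measure_ge0.
move=> [h1 h2 h3 h4]; rewrite big_cons EFinD.
have h5 := chain_in_le h4.
have -> : (p.2 - p.1)%:E = mu `[p.1, p.2[%classic.
  rewrite lebesgue_measure_itv/= lte_fin; case: ltP => // h.
  by rewrite (_ : p.2 = p.1) ?subrr//; apply/eqP; rewrite eq_le h1 h.
apply: (@le_trans _ _ (mu `[p.1, p.2[%classic + mu (O `&` `[a, p.1[))%E).
  by rewrite leeD2l// IH.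
rewrite -measureU//; last 2 first.
- exact: mI.
- apply/seteqP; split=> // x [] /=; rewrite !in_itv/= => /andP[p1x _] [_ /andP[_]].
  by rewrite ltNge p1x.
apply: le_measure; rewrite ?inE; [|exact: mI|].
  by apply: measurableU; [exact: measurable_itv|exact: mI].
move=> x /= [|[Ox]]; rewrite !in_itv/= => /andP[k1 k2].
  split; first by apply: h3; rewrite /= in_itv/= k1 ltW.
  by rewrite (le_trans h5 k1) (lt_le_trans k2 h2).
by split=> //; rewrite k1 (lt_le_trans k2)// (le_trans h1 h2).
Qed.

Lemma chain_in_nth O a t s i : chain_in O a t s -> (i < size s)%N ->
  let p := nth (0, 0) s i in [/\ a <= p.1, p.1 <= p.2 & p.2 <= t].
Proof.
elim: s t i => //= p s IH t [|i] /= [h1 h2 h3 h4].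
  by move=> _; split=> //; exact: chain_in_le h4.
rewrite ltnS => /(IH _ _ h4) [k1 k2 k3]; split=> //.
by rewrite (le_trans k3)// (le_trans h1).
Qed.

Lemma chain_in_disj O a t s i j : chain_in O a t s -> (i < j < size s)%N ->
  (nth (0, 0) s j).2 <= (nth (0, 0) s i).1.
Proof.
elim: s t i j => [|p s IH] t i j /=; first by rewrite ltn0 andbF.
move=> [h1 h2 h3 h4]; case: j => // j; rewrite ltnS.
case: i => [|i] /andP[ij js] /=; first by case: (chain_in_nth h4 js).
by apply: (IH _ _ _ h4); rewrite ij.
Qed.

Lemma chain_in_abs_cont O phi a b (e d : R) s :
  (forall (k : nat) (x y : 'I_k -> R),
      (forall i, a <= x i /\ x i <= y i /\ y i <= b) ->
      (forall i j, i != j -> y i <= x j \/ y j <= x i) ->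
      \sum_(i < k) (y i - x i) < d ->
      \sum_(i < k) `|phi (y i) - phi (x i)| < e) ->
  chain_in O a b s -> \sum_(p <- s) (p.2 - p.1) < d ->
  \sum_(p <- s) `|phi p.2 - phi p.1| < e.
Proof.
move=> ac ch; rewrite !(big_nth (0, 0)) !big_mkord; apply: ac => [i|i j ij].
  by have [] := chain_in_nth ch (ltn_ord i).
have [ij'|ji|/val_inj/eqP] := ltngtP i j; last by rewrite (negPf ij).
  by right; apply: (chain_in_disj ch); rewrite ij' ltn_ord.
by left; apply: (chain_in_disj ch); rewrite ji ltn_ord.
Qed.

Definition convex (C : set V) := forall x y (l : R), C x -> C y -> 0 <= l <= 1 ->
  C (l *: x + (1 - l) *: y).

(* Cousin-type covering: a point of differentiability controls every small
   interval around it, and the exceptional null set is covered by an open set so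
   small that absolute continuity makes its contribution negligible. *)
Lemma mean_value_inclusion phi a b (C : set V) (M e : R) : a < b -> 0 < e ->
  convex C -> (forall v, C v -> `|v| <= M) -> abs_cont_on phi a b ->
  {ae mu, forall t, a < t < b -> derivable phi t 1 /\ C ('D_1 phi t)} ->
  exists2 w, C w & `|phi b - phi a - (b - a) *: w| <= e.
Proof.
move=> ab e0 cC CM ac aeC.
have ba0 : 0 < b - a by rewrite subr_gt0.
have e3 : 0 < e / 3 by rewrite divr_gt0.
have [d1 d10 acd] := ac _ e3.
pose M1 := `|M| + 1; have M10 : 0 < M1 by rewrite ltr_wpDl.
(* The three bounds on the exceptional length: [d1] makes the increments over it small, [b - a]
   leaves some good length, and [e / 3 / M1] makes its product with a velocity small. *)
pose d := Num.min d1 (Num.min (b - a) (e / 3 / M1)).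
have d0 : 0 < d by rewrite !lt_min d10 ba0 divr_gt0.
(* The endpoints join the exceptional set, because the derivative is controlled only strictly
   between them. *)
have [N [mN N0 NP]] := ae_and (ae_and (ae_neq a) (ae_neq b)) aeC.
have negN : mu.-negligible N by exists N; split.
have [W [oO NO muO]] := negligible_open_cover d0 negN.
pose e1 := e / 3 / (b - a); have e10 : 0 < e1 by rewrite divr_gt0.
pose len (s : seq (R * R)) := \sum_(p <- s) (p.2 - p.1).
pose inc (s : seq (R * R)) := \sum_(p <- s) (phi p.2 - phi p.1).
(* The chain [s] collects the exceptional intervals up to [t]; on the remaining length [phi] moves
   with mean velocity [w]. As long as that length is zero, [w] is a placeholder and only its norm is
   controlled. *)
pose E t := exists s w, [/\ chain_in W a t s, 0 <= t - a - len s,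
  0 < t - a - len s -> C w, `|w| <= M1 &
  `|phi t - phi a - inc s - (t - a - len s) *: w| <= e1 * (t - a - len s)].
have : E b.
  apply: (@continuous_induction _ a b) => [||t /andP[a_t t_b]]; first exact: ltW.
    exists [::], 0; rewrite /len /inc !big_nil !subrr scaler0 subrr mulr0 !normr0.
    by split; rewrite ?ltxx ?(ltW M10)//= lexx.
  have [tO|tO] := pselect (W t).
    have /nbhs_ballP[r /= r0 rO] : nbhs t W by exact: open_nbhs_nbhs.
    exists r => // u v [s [w [h1 h2 h3 h4 h5]]] au tu ut tv vt vb.
    exists ((u, v) :: s), w.
    have -> : len ((u, v) :: s) = v - u + len s by rewrite /len big_cons.
    have -> : inc ((u, v) :: s) = phi v - phi u + inc s by rewrite /inc big_cons.
    have -> : v - a - (v - u + len s) = u - a - len s by ring.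
    have -> : phi v - phi a - (phi v - phi u + inc s) = phi u - phi a - inc s.
      by apply/matrixP => i j; rewrite !mxE; ring.
    split=> //=; split=> //; first exact: le_trans tv.
    move=> x /=; rewrite in_itv/= => /andP[ux xv]; apply: rO.
    by rewrite -ball_normE /= ltr_norml; lra.
  have [/eqP ta /eqP tb dC] : [/\ t != a, t != b & a < t < b ->
      derivable phi t 1 /\ C ('D_1 phi t)].
    apply: contrapT => nP; apply: tO; apply: NO; apply: NP => /= -[[? ?] ?].
    by apply: nP; split.
  have [|dt Ct] := dC.
    by rewrite !lt_neqAle a_t t_b !andbT; apply/andP; split; apply/eqP => // /esym.
  have [r r0 rP] := derivable_straddle dt e10.
  exists r => // u v [s [w [h1 h2 h3 h4 h5]]] au tu ut tv vt vb.
  have := rP u v tu ut tv vt; set p := 'D_1 phi t => hp.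
  set l := u - a - len s in h2 h3 h5.
  have uv : u <= v by exact: le_trans tv.
  have vu0 : 0 <= v - u by rewrite subr_ge0.
  have lE : v - a - len s = l + (v - u) by rewrite /l; ring.
  (* The new mean velocity weights the old one and the derivative at [t] by the lengths they account
     for. *)
  pose w' := (l + (v - u))^-1 *: (l *: w + (v - u) *: p).
  have [l0|l0] := eqVneq (l + (v - u)) 0.
    have uv' : u = v by apply/eqP; rewrite eq_le uv/=; lra.
    exists s, w; rewrite -uv'; split=> //.
  have l0' : 0 < l + (v - u) by lra.
  exists s, w'; rewrite lE; split.
  - exact: chain_in_widen h1.
  - exact: ltW.
  - move=> _; rewrite /w' scalerDr !scalerA.
    (* With no good length before [u], [w] may lie outside [C], and the mean is [p] alone. *)
    have [l00|l00] := eqVneq l 0.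
      rewrite l00 mulr0 scale0r !add0r mulVf ?scale1r//.
      by rewrite l00 add0r in l0.
    have -> : (l + (v - u))^-1 * (v - u) = 1 - (l + (v - u))^-1 * l.
      by field.
    apply: cC => //; first by apply: h3; rewrite lt_neqAle eq_sym l00.
    rewrite mulr_ge0 ?invr_ge0 ?(ltW l0')//= mulrC ler_pdivrMr// mul1r; lra.
  - rewrite /w' normrZ ger0_norm ?invr_ge0 ?(ltW l0')// mulrC ler_pdivrMr//.
    rewrite (le_trans (ler_normD _ _))// mulrDr !normrZ (ger0_norm h2) (ger0_norm vu0).
    apply: lerD; rewrite [leRHS]mulrC ler_wpM2l//.
    by apply: (le_trans (CM _ Ct)); rewrite (le_trans (ler_norm _))// lerDl.
  - have -> : phi v - phi a - inc s - (l + (v - u)) *: w' =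
      (phi u - phi a - inc s - l *: w) + (phi v - phi u - (v - u) *: p).
      rewrite /w' scalerA mulfV// scale1r.
      by apply/matrixP => i j; rewrite !mxE; ring.
    by rewrite (le_trans (ler_normD _ _))// mulrDr lerD.
move=> [s [w [h1 h2 h3 h4 h5]]].
have lend : len s < d.
  rewrite -lte_fin; apply: le_lt_trans muO.
  apply: (le_trans (chain_in_measure oO h1)); apply: le_measure; rewrite ?inE.
  - by apply: measurableI; [exact: open_measurable|exact: measurable_itv].
  - exact: open_measurable.
  - by move=> x [].
have len0 : 0 <= len s.
  rewrite /len (big_nth (0, 0)) big_mkord; apply: sumr_ge0 => i _.
  by rewrite subr_ge0; case: (chain_in_nth h1 (ltn_ord i)).
move: (lend); rewrite !lt_min => /and3P[l1 l2 l3].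
exists w; first by apply: h3; rewrite subr_gt0.
have -> : phi b - phi a - (b - a) *: w =
  (phi b - phi a - inc s - (b - a - len s) *: w) + inc s - len s *: w.
  by apply/matrixP => i j; rewrite !mxE; ring.
(* The three errors: the good part, the increments over the chain, and [w] charged to the length of
   the chain. *)
have -> : e = e / 3 + e / 3 + e / 3 by field.
apply: (le_trans (ler_normB _ _)); apply: lerD; last first.
  rewrite normrZ (ger0_norm len0) (le_trans (ler_wpM2l len0 h4))//.
  by rewrite -ler_pdivlMr// ltW.
apply: (le_trans (ler_normD _ _)); apply: lerD; last first.
  apply: (le_trans (ler_norm_sum _ _ _)); apply: ltW.
  exact: (chain_in_abs_cont acd h1).
have -> : e / 3 = e1 * (b - a) by rewrite /e1 divfK// gt_eqF.
by rewrite (le_trans h5)// ler_pM2l// gerBl.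
Qed.

End mean_value.

(** * Solutions on intervals *)

Section solutions_on_intervals.
Context {R : realType} {n : nat}.
Notation V := 'rV[R]_n.
Notation mu := (@lebesgue_measure R).
Implicit Types (F : V -> set V) (phi psi : R -> V) (a b c t : R).

(** An expansion with the derivative as an argument passes through translations, reflections and
    local equality without handling difference quotients. *)
Definition has_deriv phi t (p : V) := forall e : R, 0 < e ->
  exists2 d : R, 0 < d & forall h : R, `|h| < d ->
    `|phi (t + h) - phi t - h *: p| <= e * `|h|.

Lemma has_derivP phi t p :
  has_deriv phi t p <-> derivable phi t 1 /\ 'D_1 phi t = p.
Proof.
split=> [dp|[dphi <- e e0]]; last exact: derivable_approx.
suff cv : h^-1 *: (phi (h *: 1 + t) - phi t) @[h --> 0^'] --> p.
  by split; [apply/cvg_ex; exists p|apply/cvg_lim].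
apply/cvgrPdist_le => e /dp[d d0 dP]; exists d => //= h.
rewrite /= sub0r normrN => /dP hh h0.
rewrite (_ : h *: 1 = h); last by rewrite /GRing.scale/= mulr1.
rewrite -(ler_pM2r (_ : 0 < `|h|)) ?normr_gt0//; apply: le_trans hh.
rewrite [leLHS]mulrC -normrZ scalerBr scalerA mulfV// scale1r distrC.
by rewrite (addrC t h).
Qed.

Lemma has_deriv_ex F phi t :
  (derivable phi t 1 /\ F (phi t) ('D_1 phi t)) <->
  exists2 p, has_deriv phi t p & F (phi t) p.
Proof.
split=> [[dphi Fphi]|[p /has_derivP[dphi <-]]//].
by exists ('D_1 phi t) => //; apply/has_derivP.
Qed.

Lemma has_deriv_shift phi t c p :
  has_deriv phi (c + t) p -> has_deriv (fun s => phi (c + s)) t p.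
Proof.
move=> dp e /dp[d d0 dP]; exists d => // h hd.
by rewrite addrA; exact: dP.
Qed.

Lemma has_deriv_reflect phi t c p :
  has_deriv phi (c - t) p -> has_deriv (fun s => phi (c - s)) t (- p).
Proof.
move=> dp e /dp[d d0 dP]; exists d => // h hd.
by have := dP (- h); rewrite normrN scalerN scaleNr opprD addrA; exact.
Qed.

Lemma has_deriv_eq phi psi t p a b : a < t < b ->
  (forall s, a <= s <= b -> phi s = psi s) ->
  has_deriv phi t p -> has_deriv psi t p.
Proof.
move=> /andP[at_ tb] eqf dp e /dp[d d0 dP].
exists (Num.min d (Num.min (t - a) (b - t))).
  by rewrite !lt_min d0 !subr_gt0 at_.
move=> h; rewrite !lt_min => /and3P[hd]; rewrite !ltr_norml.
move=> /andP[h1 h2] /andP[h3 h4].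
by rewrite -!eqf; [exact: dP|lra..].
Qed.

(** The inclusion is asked only in the open interval, so the notion depends only on the values of
    [phi] on [[a, b]] and pieces can be glued. *)
Definition sol_on F phi a b := abs_cont_on phi a b /\
  {ae mu, forall t, a < t < b -> derivable phi t 1 /\ F (phi t) ('D_1 phi t)}.

Lemma sol_on_sub F phi a b c d : a <= c -> d <= b ->
  sol_on F phi a b -> sol_on F phi c d.
Proof.
move=> ac db [acphi dphi]; split; first exact: abs_cont_sub acphi.
by apply: ae_imp dphi => t dt /andP[ct td]; apply: dt; lra.
Qed.

Lemma sol_on_degenerate F phi a b : b <= a -> sol_on F phi a b.
Proof.
move=> ba; split; last by apply: aeW => t /andP[? ?]; exfalso; lra.
apply: (@lipschitz_abs_cont _ _ _ _ _ 0) => x y ax xy yb.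
by have -> : x = y; [lra|rewrite !subrr normr0 mulr0].
Qed.

Lemma eq_sol_on F phi psi a b : (forall t, a <= t <= b -> phi t = psi t) ->
  sol_on F phi a b -> sol_on F psi a b.
Proof.
move=> eqf [acphi dphi]; split.
  move=> e /acphi[d d0 dP]; exists d => // k x y xy dis sd.
  rewrite (eq_bigr (fun i => `|phi (y i) - phi (x i)|)); first exact: dP.
  by move=> i _; have [h1 [h2 h3]] := xy i; rewrite -!eqf//; lra.
apply: ae_imp dphi => t dt tab; have /has_deriv_ex[p dp Fp] := dt tab.
apply/has_deriv_ex; exists p; first exact: (has_deriv_eq tab eqf dp).
by rewrite -eqf//; case/andP: tab => *; apply/andP; split; exact: ltW.
Qed.

(** Each interval is cut at [b] by [Num.min _ b] and [Num.max _ b]; a piece on the wrong side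
    degenerates to a point, and both families stay non-overlapping. *)
Lemma abs_cont_trans phi a b c : a <= b -> b <= c ->
  abs_cont_on phi a b -> abs_cont_on phi b c -> abs_cont_on phi a c.
Proof.
move=> ab bc ac1 ac2 e e0; have e20 : 0 < e / 2 by rewrite divr_gt0.
have [d1 d10 d1P] := ac1 _ e20; have [d2 d20 d2P] := ac2 _ e20.
exists (Num.min d1 d2); first by rewrite lt_min d10.
move=> k x y xy dis; rewrite lt_min => /andP[sd1 sd2].
have split_phi z : phi z = phi (Num.min z b) + phi (Num.max z b) - phi b.
  by case: (leP z b) => zb; rewrite ?addrK// (addrC (phi b)) addrK.
have -> : e = e / 2 + e / 2 by rewrite -splitr.
apply: (@le_lt_trans _ _
  (\sum_(i < k) `|phi (Num.min (y i) b) - phi (Num.min (x i) b)| +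
   \sum_(i < k) `|phi (Num.max (y i) b) - phi (Num.max (x i) b)|)).
  rewrite -big_split/=; apply: ler_sum => i _.
  rewrite (split_phi (y i)) (split_phi (x i)).
  apply: le_trans (ler_normD _ _); rewrite le_eqVlt; apply/orP; left; apply/eqP.
  by congr `|_|; apply/matrixP => ? ?; rewrite !mxE; ring.
have minle i : Num.min (y i) b - Num.min (x i) b <= y i - x i.
  have [h1 [h2 h3]] := xy i.
  by case: (leP (y i) b) => ?; case: (leP (x i) b) => ?; lra.
have maxle i : Num.max (y i) b - Num.max (x i) b <= y i - x i.
  have [h1 [h2 h3]] := xy i.
  by case: (leP (y i) b) => ?; case: (leP (x i) b) => ?; lra.
apply: ltrD.
- apply: d1P.
  + move=> i; have [h1 [h2 h3]] := xy i.
    by split; [rewrite le_min h1|split; [exact: le_min2|rewrite ge_min lexx orbT]].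
  + by move=> i j ij; case: (dis i j ij) => h; [left|right]; exact: le_min2.
  + by apply: le_lt_trans sd1; apply: ler_sum => i _.
- apply: d2P.
  + move=> i; have [h1 [h2 h3]] := xy i.
    by split; [rewrite le_max lexx orbT|split; [exact: le_max2|rewrite ge_max h3]].
  + by move=> i j ij; case: (dis i j ij) => h; [left|right]; exact: le_max2.
  + by apply: le_lt_trans sd2; apply: ler_sum => i _.
Qed.

Lemma sol_on_trans F phi a b c : a <= b -> b <= c ->
  sol_on F phi a b -> sol_on F phi b c -> sol_on F phi a c.
Proof.
move=> ab bc [ac1 d1] [ac2 d2]; split; first exact: abs_cont_trans ac2.
apply: ae_imp (ae_and (ae_neq b) (ae_and d1 d2)) => t [tb [h1 h2]] /andP[at_ tc].
have [t_b|b_t|tbE] := ltgtP t b; last by rewrite tbE eqxx in tb.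
  by apply: h1; rewrite at_.
by apply: h2; rewrite b_t.
Qed.

Lemma sol_on_shift F phi a b c : sol_on F phi a b ->
  sol_on F (fun t => phi (c + t)) (a - c) (b - c).
Proof.
move=> [acphi dphi]; split.
  move=> e /acphi[d d0 dP]; exists d => // k x y xy dis sd.
  apply: (dP k (fun i => c + x i) (fun i => c + y i)).
  - by move=> i; have [h1 [h2 h3]] := xy i; split; [lra|split; lra].
  - by move=> i j /dis[h|h]; [left|right]; rewrite lerD2l.
  - by under eq_bigr do rewrite opprD addrACA subrr add0r.
apply: ae_imp (ae_shift c dphi) => t dt tab.
have /has_deriv_ex[p dp Fp] := dt ltac:(lra).
by apply/has_deriv_ex; exists p => //; exact: has_deriv_shift.
Qed.

Lemma neg_fieldK F : neg_field (neg_field F) = F.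
Proof. by apply/funext => x; apply/seteqP; split=> v; rewrite /neg_field/= opprK. Qed.

Lemma sol_on_reflect F phi a b c : sol_on F phi a b ->
  sol_on (neg_field F) (fun t => phi (c - t)) (c - b) (c - a).
Proof.
move=> [acphi dphi]; split.
  move=> e /acphi[d d0 dP]; exists d => // k x y xy dis sd.
  under eq_bigr do rewrite distrC.
  apply: (dP k (fun i => c - y i) (fun i => c - x i)).
  - by move=> i; have [h1 [h2 h3]] := xy i; split; [lra|split; lra].
  - by move=> i j /dis[h|h]; [right|left]; lra.
  - apply: le_lt_trans sd; apply: ler_sum => i _; lra.
apply: ae_imp (ae_reflect c dphi) => t dt tab.
have /has_deriv_ex[p dp Fp] := dt ltac:(lra).
apply/has_deriv_ex; exists (- p); first exact: has_deriv_reflect.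
by rewrite /neg_field/= opprK.
Qed.

Lemma sol_domain0 (D : set R) : sol_domain D -> D 0.
Proof.
case=> [->|[T [[T0 ->]|[T0 ->]]]]; rewrite /= in_itv/= lexx//.
Qed.

Lemma sol_domain_ge0 (D : set R) t : sol_domain D -> D t -> 0 <= t.
Proof.
case=> [->|[T [[T0 ->]|[T0 ->]]]]; rewrite /= in_itv/=; first by rewrite andbT.
all: by case/andP.
Qed.

Lemma sol_domain_down (D : set R) s t : sol_domain D -> D t -> 0 <= s <= t -> D s.
Proof.
case=> [->|[T [[T0 ->]|[T0 ->]]]]; rewrite /= !in_itv/=.
- by move=> _ /andP[->].
- by move=> /andP[_ tT] /andP[-> /le_trans]; exact.
- by move=> /andP[_ tT] /andP[-> /le_lt_trans]; exact.
Qed.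

(** Down-closedness is easy to check for unions of domains. Boundedness, and whether the supremum is
    attained, then decide the shape. *)
Lemma sol_domainP (D : set R) : D 0 -> (forall t, D t -> 0 <= t) ->
  (forall s t, D t -> 0 <= s <= t -> D s) -> sol_domain D.
Proof.
move=> D0 Dge0 Ddown.
have [Dub|nub] := pselect (has_ubound D); last first.
  left; apply/seteqP; split=> t /=; rewrite in_itv/= andbT; first exact: Dge0.
  move=> t0; apply: contrapT => nDt; apply: nub; exists t => s Ds.
  by rewrite leNgt; apply/negP => ts; apply: nDt; apply: (Ddown t s); rewrite // t0 ltW.
have supD : has_sup D by split => //; exists 0.
right; exists (sup D).
have sup0 : 0 <= sup D by exact: ub_le_sup.
have ltD t : 0 <= t -> t < sup D -> D t.
  move=> t0; rewrite -subr_gt0 => /sup_adherent/(_ supD)[u Du]; rewrite subKr => tu.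
  by apply: (Ddown _ u) => //; rewrite t0 ltW.
have leD t : D t -> t <= sup D by exact: ub_le_sup.
have [DS|DS] := pselect (D (sup D)); [left|right]; split => //.
- apply/seteqP; split=> t /=; rewrite in_itv/=; first by move=> Dt; rewrite Dge0// leD.
  by move=> tS; exact: Ddown tS.
- rewrite lt_neqAle sup0 andbT; apply/eqP => S0; by rewrite -S0 in DS.
- apply/seteqP; split=> t /=; rewrite in_itv/=; last by move=> /andP[]; exact: ltD.
  move=> Dt; rewrite Dge0//= lt_neqAle leD// andbT.
  by apply/eqP => tS; rewrite -tS in DS.
Qed.

(** A countable family of times lets almost everywhere statements on the intervals [[0, q k]]
    combine into one on [D]. *)
Lemma sol_domain_exhaust (D : set R) : sol_domain D ->
  exists2 q : nat -> R, forall k, D (q k) &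
    forall t u : R, D u -> t < u -> exists k, t < q k.
Proof.
move=> sD; have D0 := sol_domain0 sD.
(* The rationals are enumerated; those above all of [D], and the negative ones, are replaced by
   [0]. *)
pose q k : R := if pselect (exists2 u, D u & u >= ratr (odflt 0%Q (unpickle k))) then
   Num.max 0 (ratr (odflt 0%Q (unpickle k))) else 0.
exists q => [k|t u Du tu].
  rewrite /q; case: pselect => // -[u Du qu]; apply: (sol_domain_down sD Du).
  by rewrite le_max lexx ge_max qu (sol_domain_ge0 sD Du).
have [r] := rat_in_itvoo tu; rewrite in_itv/= => /andP[tr ru].
exists (pickle r); rewrite /q pickleK/=; case: pselect => [?|nq] /=.
  by rewrite lt_max tr orbT.
by exfalso; apply: nq; exists u => //; exact: ltW.
Qed.

Lemma is_solutionP F x (D : set R) phi : is_solution F x D phi <->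
  [/\ sol_domain D, phi 0 = x & forall T, D T -> sol_on F phi 0 T].
Proof.
split=> [[sD phi0 acphi dphi]|[sD phi0 so]].
  split=> // T DT; split.
    by apply: acphi; [exact: sol_domain0|exact: DT|exact: sol_domain_ge0 DT].
  apply: ae_imp dphi => t dt /andP[t0 tT]; apply: dt.
  by apply: (sol_domain_down sD DT); rewrite !ltW.
split=> // [a b Da Db ab|].
  by apply: abs_cont_sub (so _ Db).1 => //; exact: sol_domain_ge0 Da.
have [q Dq qexh] := sol_domain_exhaust sD.
have := ae_foralln (fun k => (so _ (Dq k)).2).
(* A last time of [D] is interior to no [[0, q k]], so [sup D] is discarded along with [0]. *)
move=> /(ae_and (ae_and (ae_neq 0) (ae_neq (sup D)))).
apply: ae_imp => t [[t0 tS] tk] Dt.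
have tgt0 : 0 < t by rewrite lt_neqAle eq_sym t0 (sol_domain_ge0 sD Dt).
have [u Du tu] : exists2 u, D u & t < u.
  apply: contrapT => nu; have ub u : D u -> u <= t.
    by move=> Du; rewrite leNgt; apply/negP => tu; apply: nu; exists u.
  move/eqP: tS; apply; apply/eqP; rewrite eq_le; apply/andP; split.
    by apply: ub_le_sup => //; exists t.
  by apply: sup_le_ub => //; exists t.
by have [k tqk] := qexh _ _ Du tu; apply: (tk k); rewrite tgt0.
Qed.

End solutions_on_intervals.

(** * Extension to total solutions *)

Section total_solutions.
Context {R : realType} {n : nat}.
Notation V := 'rV[R]_n.
Implicit Types (F : V -> set V) (phi psi : R -> V) (x : V) (D : set R).

Definition total_sol F x psi := psi 0 = x /\ forall T, 0 <= T -> sol_on F psi 0 T.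

Let extends (p q : set R * (R -> V)) :=
  p.1 `<=` q.1 /\ forall t, p.1 t -> q.2 t = p.2 t.

Let extends_trans p q r : extends p q -> extends q r -> extends p r.
Proof.
move=> [pq Epq] [qr Eqr]; split=> [|t pt]; first exact: subset_trans qr.
by rewrite Eqr ?Epq//; exact: pq.
Qed.

(** This is the upper bound for Zorn's lemma: the domains are united, and the values glue because
    members of a chain agree where both are defined. *)
Lemma solution_chain_bound F x (A : set (set R * (R -> V))) p0 : A p0 ->
  (forall p, A p -> is_solution F x p.1 p.2) ->
  (forall p q, A p -> A q -> extends p q \/ extends q p) ->
  exists2 m, is_solution F x m.1 m.2 & forall p, A p -> extends p m.
Proof.
move=> Ap0 Asol Atot.
pose U := [set t | exists2 p, A p & p.1 t].
pose pick t := xget p0 [set p | A p /\ p.1 t].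
pose phi t := (pick t).2 t.
have phiE p t : A p -> p.1 t -> phi t = p.2 t.
  move=> Ap pt; have [Aq qt] : A (pick t) /\ (pick t).1 t.
    by apply: (xgetPex p0 (P := [set p | A p /\ p.1 t])); exists p.
  rewrite /phi; have [[_ ->//]|[_ ->//]] := Atot _ _ Ap Aq.
have sdom p : A p -> sol_domain p.1 by move=> /Asol[].
exists (U, phi); last first.
  by move=> p Ap; split=> /= [t pt|t pt]; [exists p|exact: phiE].
apply/is_solutionP; split=> /=.
- apply: sol_domainP.
  + by exists p0 => //; apply: sol_domain0; exact: sdom.
  + by move=> t [p Ap pt]; exact: (sol_domain_ge0 (sdom _ Ap) pt).
  + move=> s t [p Ap pt] st; exists p => //.
    exact: (sol_domain_down (sdom _ Ap) pt st).
- rewrite (phiE p0)//; first by case: (Asol _ Ap0).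
  by apply: sol_domain0; exact: sdom.
- move=> T [p Ap pT]; have /is_solutionP[_ _ /(_ _ pT)] := Asol _ Ap.
  apply: eq_sol_on => t tT; rewrite (phiE p)//.
  exact: (sol_domain_down (sdom _ Ap) pT tT).
Qed.

(** Completeness forces a maximal extension to have unbounded domain, and an unbounded admissible
    domain contains all nonnegative times. *)
Lemma forward_complete_extend F x D phi : forward_complete F ->
  is_solution F x D phi ->
  exists2 psi, total_sol F x psi & forall t, D t -> psi t = phi t.
Proof.
move=> fc sphi.
pose T := {p : set R * (R -> V) | is_solution F x p.1 p.2 /\ extends (D, phi) p}.
pose rl (p q : T) := `[< extends (sval p) (sval q) >].
have exx p : extends p p by split.
have t0 : T by exists (D, phi).
(* Values outside the domain are arbitrary, so [extends] is only a preorder. *)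
have [|||m mmax] := @ZL_preorder T t0 rl.
- by move=> p; apply/asboolP.
- move=> p q r /asboolP pq /asboolP qr; apply/asboolP; exact: extends_trans qr.
- move=> A Atot; have [[p0 Ap0]|A0] := pselect (A !=set0); last first.
    by exists t0 => s As; exfalso; apply: A0; exists s.
  have [|||m sm mub] := @solution_chain_bound F x (sval @` A) (sval p0).
  + by exists p0.
  + by move=> _ [p Ap <-]; case: (svalP p).
  + move=> _ _ [p Ap <-] [q Aq <-].
    by have [/asboolP|/asboolP] := Atot _ _ Ap Aq; [left|right].
  have Dm : extends (D, phi) m.
    by apply: extends_trans (svalP p0).2 _; apply: mub; exists p0.
  exists (exist _ m (conj sm Dm)) => s As; apply/asboolP => /=.
  by apply: mub; exists s.
case: m mmax => -[D' psi] [/= spsi [/= DD' Epsi]] mmax.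
have maxpsi : maximal_solution F x D' psi.
  split=> // -[D'' [chi [schi D'D'' Echi]]].
  have ext : extends (D, phi) (D'', chi).
    split=> [t Dt|t Dt] /=; first by apply: (properW D'D''); exact: (DD' _ Dt).
    by rewrite Echi ?Epsi//; exact: (DD' _ Dt).
  have := mmax (exist _ (D'', chi) (conj schi ext)).
  have [_ nsub] := D'D''.
  move=> /(_ _)/asboolP[]; first by apply/asboolP; split=> //=; exact: properW.
  by move=> /= /nsub.
have nub := fc _ _ _ maxpsi.
have /is_solutionP[sD psi0 spsiT] := spsi.
exists psi => //; split=> // t t_ge0; apply: spsiT.
apply: contrapT => nD't; apply: nub; exists t => s D's.
rewrite leNgt; apply/negP => ts; apply: nD't.
by apply: (sol_domain_down sD D's); rewrite t_ge0 ltW.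
Qed.

Lemma total_sol_exists F x : forward_complete F -> exists psi, total_sol F x psi.
Proof.
move=> fc.
(* The solution to extend is the trivial one, on the domain reduced to time [0]. *)
have [|psi psiT _] := @forward_complete_extend F x `[0, 0]%classic (fun=> x) fc.
  apply/is_solutionP; split=> //; first by right; exists 0; left.
  move=> T; rewrite /= in_itv/= => /andP[_ T0]; exact: sol_on_degenerate.
by exists psi.
Qed.

End total_solutions.

(** * Limits of solutions *)

Section compactness.
Context {R : realType} {n : nat}.
Notation V := 'rV[R]_n.
Notation mu := (@lebesgue_measure R).
Implicit Types (H : V -> set V) (phi psi : R -> V).

Definition lip_on phi a b (L : R) := forall x y, a <= x -> x <= y -> y <= b ->
  `|phi y - phi x| <= L * (y - x).

Lemma usc_locally_bounded H z : usc_setvalued H -> compact (H z) ->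
  exists r M : R, [/\ 0 < r, 0 < M &
    forall y, `|z - y| < r -> forall v, H y v -> `|v| <= M].
Proof.
move=> usc /compact_bounded cH.
have [M M0 HM] : exists2 M : R, 0 < M & forall v, H z v -> `|v| <= M.
  by have [M M0 HM] := pinfty_ex_gt0 cH; exists M.
have /nbhs_ballP[r /= r0 rP] := usc z 1 ltr01.
exists r, (M + 1); split=> //; first by rewrite ltr_wpDl ?ltW.
move=> y zy v Hv; have [|w Hw vw] := rP y _ v Hv; first by rewrite -ball_normE.
have -> : v = w + (v - w) by rewrite addrC subrK.
by rewrite (le_trans (ler_normD _ _))// lerD// HM.
Qed.

Lemma convex_ball (M : R) : convex [set v : V | `|v| <= M].
Proof.
move=> x y l /= xM yM /andP[l0 l1].
have l1' : 0 <= 1 - l by rewrite subr_ge0.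
have -> : M = l * M + (1 - l) * M by ring.
by rewrite (le_trans (ler_normD _ _))// !normrZ !ger0_norm// lerD// ler_wpM2l.
Qed.

Lemma convex_fatten (C : set V) (e : R) : convex C ->
  convex [set v : V | exists2 w, C w & `|v - w| <= e].
Proof.
move=> cC x y l /= [w Cw xw] [w' Cw' yw'] l01.
exists (l *: w + (1 - l) *: w'); first exact: cC.
have := @convex_ball e _ _ l xw yw' l01; congr (`|_| <= _).
by apply/matrixP => i j; rewrite !mxE; ring.
Qed.

(** The mean value inclusion for the ball of radius [M], with an arbitrarily small error. *)
Lemma sol_on_bounded_increment H psi (a b M : R) : a <= b -> 0 <= M ->
  sol_on H psi a b ->
  (forall t, a < t < b -> forall v, H (psi t) v -> `|v| <= M) ->
  `|psi b - psi a| <= M * (b - a).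
Proof.
move=> ab M0 [ac dpsi] HM; have [->|aneb] := eqVneq a b.
  by rewrite !subrr normr0 mulr0.
have altb : a < b by rewrite lt_neqAle aneb.
apply/ler_addgt0Pr => e e0.
have dM : {ae mu, forall t, a < t < b ->
    derivable psi t 1 /\ [set v : V | `|v| <= M] ('D_1 psi t)}.
  apply: ae_imp dpsi => t dt tab; have [? Hv] := dt tab; split=> //=.
  exact: HM Hv.
have [w /= wM we] :=
  mean_value_inclusion altb e0 (@convex_ball M) (fun v Mv => Mv) ac dM.
 have -> : psi b - psi a = psi b - psi a - (b - a) *: w + (b - a) *: w.
  by rewrite subrK.
rewrite (le_trans (ler_normD _ _))// addrC lerD//.
by rewrite normrZ ger0_norm ?subr_ge0// mulrC ler_wpM2r ?subr_ge0.
Qed.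

(** Inside the ball of radius [r] the speed is at most [M], so the time available is too short to
    reach its boundary. This is a continuous induction. *)
Lemma sol_on_trapped H psi z (a b r M : R) : a <= b -> 0 <= M ->
  (forall y, `|z - y| < r -> forall v, H y v -> `|v| <= M) ->
  sol_on H psi a b -> `|z - psi a| < r / 2 -> M * (b - a) < r / 2 ->
  lip_on psi a b M.
Proof.
move=> ab M0 HM spsi pa Mr.
(* The margin left after the longest possible travel; each induction step may use it up by
   continuity alone. *)
pose k := r - `|z - psi a| - M * (b - a).
have k0 : 0 < k by rewrite /k; lra.
have nn := normr_ge0 (z - psi a).
have stay : forall s, a <= s <= b -> `|z - psi s| < r.
  apply: (@continuous_induction _ a b
    [set t | forall s, a <= s <= t -> `|z - psi s| < r]) => //=.
    by move=> s sa; have -> : s = a; lra.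
  move=> t /andP[at_ tb].
  have [d d0 dP] := abs_cont_unif spsi.1 k0.
  exists (d / 2) => [|u v Eu au tu ut tv vt vb s /andP[as_ sv]].
    by rewrite divr_gt0.
  have [su|us] := leP s u; first by apply: Eu; rewrite as_.
  have incu : `|psi u - psi a| <= M * (u - a).
    apply: (@sol_on_bounded_increment H) => //.
      by apply: sol_on_sub spsi; lra.
    by move=> x /andP[ax xu]; apply: HM; apply: Eu; lra.
  have incs : `|psi s - psi u| < k by apply: dP; lra.
  have -> : z - psi s = (z - psi a) - (psi u - psi a) - (psi s - psi u).
    by apply/matrixP => i j; rewrite !mxE; ring.
  apply: (le_lt_trans (ler_normB _ _)).
  have := ler_normB (z - psi a) (psi u - psi a).
  have : M * (u - a) <= M * (b - a) by rewrite ler_wpM2l//; lra.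
  by move: incs; rewrite /k; lra.
move=> x y ax xy yb; apply: (@sol_on_bounded_increment H) => //.
  exact: sol_on_sub spsi.
by move=> t /andP[xt ty]; apply: HM; apply: stay; lra.
Qed.

Lemma lip_on_trans phi (a b c L1 L2 : R) : lip_on phi a b L1 -> lip_on phi b c L2 ->
  a <= b -> b <= c -> lip_on phi a c (Num.max L1 L2).
Proof.
move=> l1 l2 ab bc x y ax xy yc.
have m1 : L1 <= Num.max L1 L2 by rewrite le_max lexx.
have m2 : L2 <= Num.max L1 L2 by rewrite le_max lexx orbT.
have [yb|b_y] := leP y b.
  by rewrite (le_trans (l1 _ _ ax xy yb))// ler_wpM2r// subr_ge0.
have [bx|x_b] := leP b x.
  by rewrite (le_trans (l2 _ _ bx xy yc))// ler_wpM2r// subr_ge0.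
have -> : phi y - phi x = (phi y - phi b) + (phi b - phi x) by rewrite subrKA.
have -> : y - x = (y - b) + (b - x) by ring.
rewrite mulrDr (le_trans (ler_normD _ _))//; apply: lerD.
  apply: (le_trans (l2 _ _ (lexx b) (ltW b_y) yc)).
  by rewrite ler_wpM2r// subr_ge0 ltW.
apply: (le_trans (l1 _ _ ax (ltW x_b) (lexx b))).
by rewrite ler_wpM2r// subr_ge0 ltW.
Qed.

(** Along one ultrafilter all relatively compact families converge at once, so the limits at all
    times need no diagonal extraction. *)
Lemma ultra_compact_cvg (I : Type) (T : topologicalType) (U : set_system I)
    (K : set T) (f : I -> T) : UltraFilter U -> compact K ->
  (\forall k \near U, K (f k)) -> exists2 l, K l & f @ U --> l.
Proof.
move=> UU cK fK; have [l [Kl fl]] := cK (f @ U) _ fK.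
exists l => // A lA; have [//|nA] := in_ultra_setVsetC (f @^-1` A) UU.
by have [y [/= nAy Ay]] := fl (~` A) A nA lA.
Qed.

Lemma closed_norm_le (M : R) : closed [set v : V | `|v| <= M].
Proof.
rewrite (_ : [set _ | _] = (Num.norm : V -> R) @^-1` [set r | r <= M])//.
by apply: preimage_closed => [v _|]; [exact: norm_continuous|exact: closed_le].
Qed.

Lemma compact_norm_le (M : R) : compact [set v : V | `|v| <= M].
Proof.
apply: bounded_closed_compact; last exact: closed_norm_le.
exists M; split; first exact: num_real.
by move=> m Mm v /= /le_trans; apply; exact: ltW.
Qed.

Lemma cvg_near_dist (I : Type) (W : normedModType R) (U : set_system I)
    (f : I -> W) (l : W) (e : R) : Filter U -> f @ U --> l -> 0 < e ->
  \forall k \near U, `|l - f k| < e.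
Proof. by move=> UF /cvgrPdist_lt; exact. Qed.

Section limits_of_solutions.
Variables (H : V -> set V) (U : set_system nat) (psi : nat -> R -> V) (phi : R -> V).
Hypotheses (uscH : usc_setvalued H) (cptH : forall x, compact (H x))
  (cvxH : forall x, convex (H x)).
Context {UF : ProperFilter U}.

Lemma lip_on_lim (a b L : R) : (forall t, a <= t <= b -> psi ^~ t @ U --> phi t) ->
  (\forall k \near U, lip_on (psi k) a b L) -> lip_on phi a b L.
Proof.
move=> cv lipU x y ax xy yb.
have cvd : (psi k y - psi k x) @[k --> U] --> phi y - phi x.
  by apply: cvgB; apply: cv; lra.
apply/ler_addgt0Pl => e e0.
have [k [lipk /= ke]] := filter_ex (filterI lipU (cvg_near_dist _ cvd e0)).
rewrite -[X in `|X|](subrK (psi k y - psi k x)) (le_trans (ler_normD _ _))//.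
by rewrite lerD// ?lipk// ltW.
Qed.

(** By upper semicontinuity the velocities of [psi k] just after [t] lie in a convex fattening of
    [H (phi t)]. The mean value inclusion puts the difference quotients of [psi k] near it, those of
    [phi] follow in the limit, and [H (phi t)] is closed. *)
Lemma lim_velocity (a b L t : R) :
  (forall s, a <= s <= b -> psi ^~ s @ U --> phi s) ->
  (\forall k \near U, lip_on (psi k) a b L) ->
  (forall k, sol_on H (psi k) a b) -> 0 <= L ->
  a < t < b -> derivable phi t 1 -> H (phi t) ('D_1 phi t).
Proof.
move=> cv lipU sol L0 /andP[at_ tb] dphi; set p := 'D_1 phi t.
have clH : closed (H (phi t)) by apply: compact_closed => //; exact: norm_hausdorff.
have near_p (e : R) : 0 < e -> exists2 w, H (phi t) w & `|p - w| <= e.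
  (* Five errors: the mean value inclusion, the expansion of [phi], the convergence at [t] and at
     [t + h], and the fattening. *)
  move=> e0; pose e5 := e / 5; have e50 : 0 < e5 by rewrite divr_gt0.
  have /nbhs_ballP[r /= r0 rP] := uscH (phi t) e50.
  have [d d0 dP] := derivable_approx dphi e50.
  (* The three bounds keep the expansion of [phi] valid, [t + h] below [b], and [psi k] within [r]
     of [phi t] on [[t, t + h]]. *)
  pose h := Num.min (d / 2) (Num.min ((b - t) / 2) (r / 2 / (L + 1) / 2)).
  have L1 : 0 < L + 1 by lra.
  have h0 : 0 < h by rewrite !lt_min !divr_gt0// subr_gt0.
  have hd : h < d by rewrite /h gt_min; apply/orP; left; lra.
  have htb : t + h < b.
    have : h <= (b - t) / 2 by rewrite !ge_min lexx orbT.
    by lra.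
  have Lh : L * h < r / 2.
    have : h < r / 2 / (L + 1).
      rewrite !gt_min; apply/orP; right; apply/orP; right.
      by rewrite ltr_pdivrMr// ltr_pMr ?ltr1n// !divr_gt0.
    rewrite ltr_pdivlMr// mulrC mulrDl mul1r; lra.
  have cvt := cv t ltac:(lra); have cvth := cv (t + h) ltac:(lra).
  have r20 : 0 < r / 2 by rewrite divr_gt0.
  have eh0 : 0 < e5 * h by rewrite mulr_gt0.
  have [k [lipk [/= k1 [/ltW k2 /ltW k3]]]] := filter_ex (filterI lipU
    (filterI (cvg_near_dist _ cvt r20) (filterI (cvg_near_dist _ cvt eh0)
       (cvg_near_dist _ cvth eh0)))).
  have tth : t < t + h by rewrite ltrDl.
  pose C := [set v : V | exists2 w, H (phi t) w & `|v - w| <= e5].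
  have [M HM] : exists M, forall v, C v -> `|v| <= M.
    have [M _ HM] := pinfty_ex_gt0 (compact_bounded (@cptH (phi t))).
    exists (M + e5) => v [w Hw vw].
    have -> : v = w + (v - w) by rewrite addrC subrK.
    by rewrite (le_trans (ler_normD _ _))// lerD// HM.
  have sk : sol_on H (psi k) t (t + h) by apply: sol_on_sub (sol k); lra.
  have dC : {ae mu, forall s, t < s < t + h ->
      derivable (psi k) s 1 /\ C ('D_1 (psi k) s)}.
    apply: ae_imp sk.2 => s ds /[dup] /ds[dk Hk] /andP[ts sth]; split=> //.
    apply: (rP (psi k s)) => //; rewrite -ball_normE/=.
    have : `|psi k s - psi k t| <= L * (s - t) by apply: lipk; lra.
    have : L * (s - t) <= L * h by rewrite ler_wpM2l//; lra.
    have -> : phi t - psi k s = (phi t - psi k t) - (psi k s - psi k t).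
      by rewrite opprB addrA subrK.
    have := ler_normB (phi t - psi k t) (psi k s - psi k t); lra.
  have [w [w0 Hw0 ww0] wk] := mean_value_inclusion tth eh0
    (@convex_fatten (H (phi t)) e5 (@cvxH (phi t))) HM sk.1 dC.
  have hh : t + h - t = h by rewrite addrC addKr.
  rewrite hh in wk.
  exists w0 => //.
  have hpw : `|h *: (p - w)| <= e5 * h *+ 4.
    have -> : h *: (p - w) = (psi k (t + h) - psi k t - h *: w)
      - (phi (t + h) - phi t - h *: p) + (phi (t + h) - psi k (t + h))
      - (phi t - psi k t).
      by apply/matrixP => i j; rewrite !mxE; ring.
    have := dP h; rewrite (gtr0_norm h0) -/p => /(_ hd) hp.
    rewrite mulrS mulrS mulr2n addrA addrA.
    rewrite (le_trans (ler_normB _ _))// lerD//.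
    rewrite (le_trans (ler_normD _ _))// lerD//.
    by rewrite (le_trans (ler_normB _ _))// lerD.
  have pw : `|p - w| <= e5 *+ 4.
    move: hpw; rewrite normrZ (gtr0_norm h0) -mulrnAl mulrC ler_pM2r//.
  have -> : p - w0 = (p - w) + (w - w0) by rewrite subrKA.
  rewrite (le_trans (ler_normD _ _))// (_ : e = e5 *+ 4 + e5) ?lerD//.
  by rewrite /e5; field.
apply: clH => A /nbhs_ballP[e /= e0 eA].
have e20 : 0 < e / 2 by rewrite divr_gt0.
have [w Hw pw] := near_p _ e20; exists w; split=> //; apply: eA.
by rewrite -ball_normE/= (le_lt_trans pw)//; lra.
Qed.

(** The limit inherits the Lipschitz bound, hence is differentiable almost everywhere, and
    [lim_velocity] identifies its derivative. *)
Lemma sol_on_lim (a b L : R) : (forall t, a <= t <= b -> psi ^~ t @ U --> phi t) ->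
  (\forall k \near U, lip_on (psi k) a b L) -> 0 <= L ->
  (forall k, sol_on H (psi k) a b) -> sol_on H phi a b.
Proof.
move=> cv lipU L0 sol; have lipphi := lip_on_lim cv lipU.
split; first exact: lipschitz_abs_cont lipphi.
apply: ae_imp (lipschitz_ae_derivable_rV lipphi) => t dt tab; split; first exact: dt.
by apply: (lim_velocity cv lipU) => //; exact: dt.
Qed.

End limits_of_solutions.

End compactness.

(** * Ultralimits of total solutions *)

Section total_solution_limits.
Context {R : realType} {n : nat}.
Notation V := 'rV[R]_n.
Variables (H : V -> set V) (U : set_system nat) (psi : nat -> R -> V) (x : V).
Hypotheses (uscH : usc_setvalued H) (cptH : forall x, compact (H x))
  (cvxH : forall x, convex (H x)) (fcH : forward_complete H).
Hypotheses (UF : UltraFilter U) (psi0 : psi ^~ 0 @ U --> x)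
  (sol_psi : forall k T, 0 <= T -> sol_on H (psi k) 0 T).

Lemma lip_on_norm (phi : R -> V) (a b L s t : R) : lip_on phi a b L ->
  a <= s <= b -> a <= t <= b -> `|phi s - phi t| <= L * `|s - t|.
Proof.
move=> lip /andP[as_ sb] /andP[at_ tb]; have [st|/ltW ts] := leP s t.
  by rewrite distrC (distrC s) (ger0_norm (_ : 0 <= t - s)) ?subr_ge0// lip.
by rewrite (ger0_norm (_ : 0 <= s - t)) ?subr_ge0// lip.
Qed.

(** The times before which the sequence does not blow up along [U]. *)
Let G := [set t | 0 <= t /\
  exists2 L : R, 0 <= L & \forall k \near U, lip_on (psi k) 0 t L].

Let phi t := lim (psi ^~ t @ U).

Let G_domain : sol_domain G.
Proof.
apply: sol_domainP => [|t []//|s t [t0 [L L0 lipL]] /andP[s0 st]].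
  split=> //; exists 0 => //; apply: nearW => k y z y0 yz z0.
  by have -> : y = z; [lra|rewrite !subrr normr0 mulr0].
split=> //; exists L => //; apply: filterS lipL => k lipk y z y0 yz zs.
by apply: lipk => //; exact: le_trans st.
Qed.

Let cvg_phi t : G t -> psi ^~ t @ U --> phi t.
Proof.
move=> [t0 [L L0 lipL]].
have [l _ cvl] : exists2 l, [set v : V | `|v| <= L * t + (1 + `|x|)] l &
    psi ^~ t @ U --> l.
  apply: ultra_compact_cvg; first exact: compact_norm_le.
  apply: filterS (filterI lipL (cvg_near_dist _ psi0 ltr01)) => k [lipk /= xk].
  have -> : psi k t = (psi k t - psi k 0) + (psi k 0 - x + x) by rewrite !subrK.
  rewrite (le_trans (ler_normD _ _))// lerD//.
    by have := lipk 0 t (lexx _) t0 (lexx _); rewrite subr0.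
  by rewrite (le_trans (ler_normD _ _))// lerD2r distrC ltW.
exact: (cvgP _ cvl).
Qed.

Let sol_phi T : G T -> sol_on H phi 0 T.
Proof.
move=> GT; have [T0 [L L0 lipL]] := GT.
apply: (sol_on_lim uscH cptH cvxH _ lipL L0) => [t tT|k]; last exact: sol_psi.
by apply: cvg_phi; exact: (sol_domain_down G_domain GT).
Qed.

Let phi0 : phi 0 = x.
Proof. exact: (cvg_unique _ (cvg_phi (sol_domain0 G_domain)) psi0). Qed.

(* If [G] were bounded, the total extension of [phi] would reach its supremum, and
   the solutions [psi k], being trapped near that point, would stay uniformly
   Lipschitz a little longer. *)
Let G_all t : 0 <= t -> G t.
Proof.
move=> t0; apply: contrapT => nGt.
have G0 := sol_domain0 G_domain.
have ubG : has_ubound G.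
  exists t => s Gs; rewrite leNgt; apply/negP => ts; apply: nGt.
  by apply: (sol_domain_down G_domain Gs); rewrite t0 ltW.
have supG : has_sup G by split=> //; exists 0.
have [chi [chi0 solchi] chiE] : exists2 chi, total_sol H x chi &
    forall t, G t -> chi t = phi t.
  apply: forward_complete_extend => //; apply/is_solutionP; split=> //.
have T0 : 0 <= sup G by exact: ub_le_sup.
have [r [M [r0 M0 HM]]] := usc_locally_bounded uscH (@cptH (chi (sup G))).
have r40 : 0 < r / 4 by rewrite divr_gt0.
have [d d0 dP] := abs_cont_unif (solchi _ T0).1 r40.
(* The interval from [u] to [b] is shorter than [2 * h], so the travel at speed [M] is at most
   [r / 4], while [psi k u] is within [r / 2] of the center. *)
pose h := Num.min d (r / 8 / M).
have h0 : 0 < h by rewrite lt_min d0 !divr_gt0.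
have Mh : M * h <= r / 8 by rewrite mulrC -ler_pdivlMr// ge_min lexx orbT.
have [u Gu Tu] := sup_adherent h0 supG.
have uT : u <= sup G by exact: ub_le_sup.
have [u0 [L L0 lipL]] := Gu.
pose b := sup G + h.
have ub : u <= b by rewrite /b; lra.
have zu : `|chi (sup G) - chi u| < r / 4.
  have hd : h <= d by rewrite ge_min lexx.
  by apply: dP => //; lra.
have Gb : G b.
  split; first by rewrite /b; lra.
  exists (Num.max L M); first by rewrite le_max L0.
  apply: filterS (filterI lipL (cvg_near_dist _ (cvg_phi Gu) r40)) => k [lipk /= uk].
  apply: (lip_on_trans lipk) => //.
  apply: (sol_on_trapped (z := chi (sup G)) (r := r) ub (ltW M0) HM).
  - by apply: sol_on_sub (sol_psi k (_ : 0 <= b)) => //; lra.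
  - have -> : chi (sup G) - psi k u = (chi (sup G) - chi u) + (phi u - psi k u).
      by rewrite (chiE _ Gu) subrKA.
    by rewrite (le_lt_trans (ler_normD _ _))//; lra.
  - have : M * (b - u) <= M * (h + h) by rewrite ler_wpM2l ?ltW// /b; lra.
    by rewrite mulrDr; lra.
by have := ub_le_sup ubG Gb; rewrite /b; lra.
Qed.

(** The evaluation times may vary with [k], as near-optimal times for the barrier do; a common
    Lipschitz bound on [[0, s + 1]] absorbs their displacement. *)
Lemma total_sol_ultralimit : exists2 chi, total_sol H x chi &
  forall (s_ : nat -> R) s, (forall k, 0 <= s_ k) -> s_ @ U --> s ->
    psi k (s_ k) @[k --> U] --> chi s.
Proof.
exists phi; first by split=> // T T0; apply: sol_phi; exact: G_all.
move=> s_ s s_ge0 cvs.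
have s0 : 0 <= s.
  rewrite leNgt; apply/negP => sneg; have Ns : 0 < - s by lra.
  have [k /= +] := filter_ex (cvg_near_dist _ cvs Ns).
  by have := s_ge0 k; rewrite ltr_norml; lra.
have s10 : 0 <= s + 1 by lra.
have [_ [L L0 lipL]] := G_all s10.
apply/cvgrPdist_lt => e e0.
have L1 : 0 < L + 1 by lra.
have e20 : 0 < e / 2 by rewrite divr_gt0.
have eL0 : 0 < e / 2 / (L + 1) by rewrite divr_gt0.
apply: filterS (filterI lipL (filterI (cvg_near_dist _ cvs ltr01)
  (filterI (cvg_near_dist _ cvs eL0) (cvg_near_dist _ (cvg_phi (G_all s0)) e20)))).
move=> k [lipk [/= k1 [k2 k3]]].
have -> : phi s - psi k (s_ k) = (phi s - psi k s) + (psi k s - psi k (s_ k)).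
  by rewrite subrKA.
rewrite (le_lt_trans (ler_normD _ _))// [ltRHS](splitr e) ltr_leD//.
have ss : 0 <= s <= s + 1 by lra.
have sk : 0 <= s_ k <= s + 1.
  by have := s_ge0 k; move: k1; rewrite ltr_norml; lra.
apply: (le_trans (lip_on_norm lipk ss sk)).
move: k2; rewrite ltr_pdivlMr// mulrDr mulr1 mulrC.
by have := normr_ge0 (s - s_ k); lra.
Qed.

End total_solution_limits.

(** * The barrier function *)

Section neg_field_regularity.
Context {R : realType} {n : nat}.
Notation V := 'rV[R]_n.
Implicit Types F : V -> set V.

Lemma convex_setP (C : set V) : convex_set (C : set (convex_lmodType V)) -> convex C.
Proof.
move=> cC x y l Cx Cy /andP[l0 l1].
have := cC x y (Itv01 l0 l1) (mem_set Cx) (mem_set Cy).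
by rewrite inE.
Qed.

Lemma usc_neg_field F : usc_setvalued F -> usc_setvalued (neg_field F).
Proof.
move=> uscF x e /(uscF x); apply: filterS => y yF v /yF[w Fw vw].
exists (- w); first by rewrite /neg_field/= opprK.
by rewrite opprK -normrN opprD.
Qed.

Lemma compact_neg_field F x : compact (F x) -> compact (neg_field F x).
Proof.
move=> cF; have -> : neg_field F x = -%R @` F x.
  apply/seteqP; split=> [v Fv|_ [v Fv <-]]; last by rewrite /neg_field/= opprK.
  by exists (- v) => //; rewrite opprK.
apply: continuous_compact => //.
by apply: continuous_subspaceT => v; exact: opp_continuous.
Qed.

Lemma convex_neg_field F x : convex (F x) -> convex (neg_field F x).
Proof.
move=> cF v w l Fv Fw l01; rewrite /neg_field/= opprD -!scalerN.
exact: cF.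
Qed.

End neg_field_regularity.

Section barrier.
Context {R : realType} {n : nat}.
Notation V := 'rV[R]_n.
Variables (H : V -> set V) (Xo : set V).
Hypotheses (uscH : usc_setvalued H) (cptH : forall x, compact (H x))
  (cvxH : forall x, convex (H x)) (fcH : forward_complete H).
Hypotheses (clXo : closed Xo) (Xo0 : Xo !=set0).

(** Here [H] stands for the reversed field, so [psi] runs backward in time. *)
Let reaches (t : R) (x : V) (d : R) := exists psi s z,
  [/\ total_sol H x psi, 0 <= s <= t, Xo z & `|psi s - z| = d].

(** Solutions, times and points of [Xo] all have ultralimits. Fixed data [(t, x)] give attainment of
    the infimum, varying data give lower semicontinuity. *)
Lemma reaches_closed (t : R) (x : V) (a : R) :
  (forall k : nat, exists t' x' d, [/\ `|t - t'| < k.+1%:R^-1,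
     `|x - x'| < k.+1%:R^-1, reaches t' x' d & d < a + k.+1%:R^-1]) ->
  exists2 d, reaches t x d & d <= a.
Proof.
move=> near_tx.
pose P (k : nat) (y : R * V * (R -> V) * R * V) :=
  [/\ `|t - y.1.1.1.1| < k.+1%:R^-1 /\ `|x - y.1.1.1.2| < k.+1%:R^-1,
    total_sol H y.1.1.1.2 y.1.1.2, 0 <= y.1.2 <= y.1.1.1.1, Xo y.2 &
    `|y.1.1.2 y.1.2 - y.2| < a + k.+1%:R^-1].
have [f fP] : {f & forall k, P k (f k)}.
  apply: choice => k.
  have [t' [x' [d [tt' xx' [psi [s [z [h1 h2 h3 h4]]]] da]]]] := near_tx k.
  by exists (t', x', psi, s, z); split=> //=; rewrite h4.
pose t_ k := (f k).1.1.1.1; pose x_ k := (f k).1.1.1.2.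
pose psi k := (f k).1.1.2; pose s_ k := (f k).1.2; pose z_ k := (f k).2.
have [i_ iE] : {i_ : nat -> R & forall k, i_ k = k.+1%:R^-1}.
  by exists (fun k => k.+1%:R^-1).
have {}fP k : [/\ `|t - t_ k| < i_ k /\ `|x - x_ k| < i_ k,
    total_sol H (x_ k) (psi k), 0 <= s_ k <= t_ k, Xo (z_ k) &
    `|psi k (s_ k) - z_ k| < a + i_ k] by rewrite iE; exact: fP.
have [U [UU ooU]] := @ultraFilterLemma nat \oo _.
have small (e : R) : 0 < e -> \forall k \near U, i_ k < e.
  move=> e0; apply: ooU; near=> k; rewrite iE; near: k.
  exact: near_infty_natSinv_lt (PosNum e0).
have psi0 : psi ^~ 0 @ U --> x.
  apply/cvgrPdist_lt => e /small; apply: filterS => k ke.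
  by have [[_ xk] [-> _] _ _ _] := fP k; exact: lt_trans ke.
have sol_psi k T : 0 <= T -> sol_on H (psi k) 0 T.
  by have [_ [_ ] + _ _ _] := fP k; exact.
have [chi solchi chiP] := total_sol_ultralimit uscH cptH cvxH fcH UU psi0 sol_psi.
have s_ge0 k : 0 <= s_ k by have [_ _ /andP[]] := fP k.
have [s _ cvs] : exists2 s, `[0, t + 1]%classic s & s_ @ U --> s.
  apply: ultra_compact_cvg; first exact: segment_compact.
  apply: nearW => k /=; have [[tk _] _ /andP[s0 st] _ _] := fP k.
  have : i_ k <= 1 by rewrite iE invf_le1// ler1n.
  by move: tk; rewrite in_itv/= s0/= ltr_norml; lra.
have cvpsi := chiP _ _ s_ge0 cvs.
have s0 : 0 <= s.
  rewrite leNgt; apply/negP => sneg; have Ns : 0 < - s by lra.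
  have [k /= +] := filter_ex (cvg_near_dist _ cvs Ns).
  by have := s_ge0 k; rewrite ltr_norml; lra.
have st : s <= t.
  apply/ler_addgt0Pr => e e0; have e20 : 0 < e / 2 by rewrite divr_gt0.
  have [k [/= k1 k2]] := filter_ex (filterI (cvg_near_dist _ cvs e20) (small _ e20)).
  have [[tk _] _ /andP[_ stk] _ _] := fP k.
  by move: tk k1; rewrite !ltr_norml; lra.
(* [Xo] may be unbounded, but [z_ k] stays at bounded distance from the convergent
   [psi k (s_ k)]. *)
have [z _ cvz] : exists2 z, [set v : V | `|v| <= (a + 1) + (1 + `|chi s|)] z &
    z_ @ U --> z.
  apply: ultra_compact_cvg; first exact: compact_norm_le.
  apply: filterS (filterI (cvg_near_dist _ cvpsi ltr01) (small _ ltr01)).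
  move=> k [/= k1 k2]; have [_ _ _ _ zk] := fP k.
  have -> : z_ k = (z_ k - psi k (s_ k)) + ((psi k (s_ k) - chi s) + chi s).
    by rewrite !subrK.
  rewrite (le_trans (ler_normD _ _))// lerD//; first by rewrite distrC; lra.
  by rewrite (le_trans (ler_normD _ _))// lerD2r distrC ltW.
exists `|chi s - z|.
  exists chi, s, z; split=> //; first by rewrite s0.
  apply: clXo => A zA; have [k Ak] := @filter_ex _ U _ (z_ @^-1` A) (cvz _ zA).
  by exists (z_ k); split=> //; have [] := fP k.
apply/ler_addgt0Pr => e e0; have e30 : 0 < e / 3 by rewrite divr_gt0.
have [k [/= k1 [k2 k3]]] := filter_ex (filterI (cvg_near_dist _ cvpsi e30)
  (filterI (cvg_near_dist _ cvz e30) (small _ e30))).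
have [_ _ _ _ zk] := fP k.
have -> : chi s - z = (chi s - psi k (s_ k)) + (psi k (s_ k) - z_ k) - (z - z_ k).
  by rewrite subrKA opprB addrA subrK.
have := ler_normB ((chi s - psi k (s_ k)) + (psi k (s_ k) - z_ k)) (z - z_ k).
have := ler_normD (chi s - psi k (s_ k)) (psi k (s_ k) - z_ k).
by lra.
Unshelve. all: by end_near. Qed.

Definition barrier (p : R * V) : R := inf [set d | reaches p.1 p.2 d].

Let has_inf_reaches t x : 0 <= t -> has_inf [set d | reaches t x d].
Proof.
move=> t0; split; last by exists 0 => _ [psi [s [z [_ _ _ <-]]]].
have [psi solpsi] := total_sol_exists x fcH; have [z Xz] := Xo0.
by exists `|psi 0 - z|; exists psi, 0, z; rewrite lexx.
Qed.

Lemma barrier_le t x d : 0 <= t -> reaches t x d -> barrier (t, x) <= d.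
Proof. by move=> t0 rd; apply: ge_inf => //; case: (has_inf_reaches x t0). Qed.

Lemma barrier_attained t x : 0 <= t -> reaches t x (barrier (t, x)).
Proof.
move=> t0; have infr := has_inf_reaches x t0.
have [|d rd dB] := @reaches_closed t x (barrier (t, x)).
  move=> k; have k0 : 0 < k.+1%:R^-1 :> R by rewrite invr_gt0.
  have [d rd db] := inf_adherent k0 infr.
  by exists t, x, d; rewrite !subrr !normr0.
have -> // : barrier (t, x) = d.
by apply/eqP; rewrite eq_le dB barrier_le.
Qed.

Lemma barrier_near t x a : 0 <= t -> a < barrier (t, x) ->
  \forall q \near (t, x), 0 <= q.1 -> a < barrier q.
Proof.
move=> t0 aB; apply: contrapT => nnear.
have [|d rd da] := @reaches_closed t x a.
  move=> k; have k0 : 0 < k.+1%:R^-1 :> R by rewrite invr_gt0.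
  apply: contrapT => nk; apply: nnear; apply/nbhs_ballP; exists k.+1%:R^-1 => //.
  move=> [t' x'] [/= tt' xx'] t'0; rewrite ltNge; apply/negP => Ba; apply: nk.
  exists t', x', (barrier (t', x')); split.
  - by move: tt'; rewrite -ball_normE.
  - by move: xx'; rewrite -ball_normE.
  - exact: barrier_attained.
  - by rewrite (le_lt_trans Ba)// ltrDl.
by have := barrier_le t0 rd; rewrite leNgt (le_lt_trans da aB).
Qed.

Lemma barrier_lsc : lsc_on_Hplus barrier.
Proof.
move=> [t x] t0 a aB; have nearq := barrier_near t0 aB.
exists ([set q | 0 <= q.1 -> a < barrier q]°); split.
- exact: open_interior.
- exact: nearq.
- by move=> q /interior_subset.
Qed.

(** One inequality is lower semicontinuity; the other follows by using a minimizer for [t] at the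
    nearby horizon [u]. *)
Lemma barrier_continuous x :
  {within `[0, +oo[, continuous (fun t => barrier (t, x))}.
Proof.
apply/subspace_continuousP => t; rewrite /= in_itv/= andbT => t0.
apply/cvgrPdist_lt => e e0.
have Be : barrier (t, x) - e < barrier (t, x) by rewrite gtrBl.
have /nbhs_ballP[d1 /= d10 d1P] := barrier_near t0 Be.
have [psi [s [z [[psi0 solpsi] /andP[s0 st] Xz BE]]]] := barrier_attained x t0.
have [d2 d20 d2P] := abs_cont_unif (solpsi _ t0).1 e0.
exists (Num.min d1 d2); first by rewrite /= lt_min d10.
move=> u /=; rewrite lt_min => /andP[tu1 tu2]; rewrite in_itv/= andbT => u0.
rewrite ltr_norml; apply/andP; split; last first.
  have tux : ball (t, x) d1 (u, x).
    by split=> /=; [rewrite -ball_normE|exact: ballxx].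
  by have := d1P _ tux u0; lra.
suff : barrier (u, x) < barrier (t, x) + e by lra.
(* The optimal time [s] may exceed [u]; as [s <= t], truncation moves it by at most the distance
   from [t] to [u]. *)
pose v := Num.min s u.
have vs : v <= s by rewrite ge_min lexx.
have v0 : 0 <= v by rewrite le_min s0.
have vu : v <= u by rewrite ge_min lexx orbT.
have sv : s - v < d2.
  by rewrite /v; case: (leP s u) => su; move: tu2; rewrite ltr_norml; lra.
have /le_lt_trans : barrier (u, x) <= `|psi v - z|.
  by apply: barrier_le => //; exists psi, v, z; rewrite v0 vu.
apply; rewrite -BE.
have := d2P _ _ v0 vs st sv.
have -> : psi v - z = (psi s - z) - (psi s - psi v).
  by apply/matrixP => i j; rewrite !mxE; ring.
by have := ler_normB (psi s - z) (psi s - psi v); lra.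
Qed.

Lemma barrier_le0 t x : 0 <= t -> Xo x -> barrier (t, x) <= 0.
Proof.
move=> t0 Xx; have [psi [psi0 solpsi]] := total_sol_exists x fcH.
apply: barrier_le => //; exists psi, 0, x.
by rewrite psi0 subrr normr0 lexx.
Qed.

(** The horizon grows by exactly the time [c] spent going back along [phi] from [phi s2] to
    [phi s1], so a minimizer at [s1] remains admissible after this detour. *)
Lemma barrier_nonincreasing t0 (D : set R) x0 (phi : R -> V) s1 s2 :
  0 <= t0 -> is_solution (neg_field H) x0 D phi -> D s2 -> 0 <= s1 -> s1 <= s2 ->
  barrier (t0 + s2, phi s2) <= barrier (t0 + s1, phi s1).
Proof.
move=> t00 /is_solutionP[sD _ solphi] Ds2 s10 s12.
have ts1 : 0 <= t0 + s1 by rewrite addr_ge0.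
have ts2 : 0 <= t0 + s2 by rewrite (le_trans ts1)// lerD2l.
have [psi [s [z [[psi0 solpsi] /andP[s0 st] Xz BE]]]] :=
  barrier_attained (phi s1) ts1.
rewrite -BE; apply: barrier_le => //.
pose c := s2 - s1; have c0 : 0 <= c by rewrite subr_ge0.
pose chi r := if r <= c then phi (s2 - r) else psi (- c + r).
have chi_left : sol_on H chi 0 c.
  apply: (@eq_sol_on _ _ _ (fun r => phi (s2 - r))).
    by move=> r /andP[_ rc]; rewrite /chi rc.
  have := sol_on_reflect s2 (sol_on_sub s10 (lexx s2) (solphi _ Ds2)).
  by rewrite neg_fieldK subrr.
have chi_right T : c <= T -> sol_on H chi c T.
  move=> cT; apply: (@eq_sol_on _ _ _ (fun r => psi (- c + r))).
    move=> r /andP[cr _]; rewrite /chi; case: leP => // rc.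
    have -> : r = c by apply/eqP; rewrite eq_le rc.
    by rewrite addNr psi0 /c subKr.
  have := sol_on_shift (- c) (solpsi (T - c) (_ : 0 <= T - c)).
  by rewrite opprK add0r subrK subr_ge0; exact.
exists chi, (c + s), z; split=> //.
- split=> [|T T0]; first by rewrite /chi c0 subr0.
  have [Tc|/ltW cT] := leP T c; first exact: sol_on_sub chi_left.
  by apply: (sol_on_trans c0 cT) => //; exact: chi_right.
- by rewrite addr_ge0//= /c; lra.
- congr (`|_ - _|); rewrite /chi; case: leP => [cs|_]; last by rewrite addKr.
  have -> : s = 0 by lra.
  by rewrite addr0 /c subKr psi0.
Qed.

(** A zero infimum is attained, so a backward solution from [x] meets [Xo]; reversed, it leads from
    [Xo] into [Xu]. *)
Lemma barrier_gt0 (Xu : set V) t x : safe (neg_field H) Xo Xu ->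
  0 <= t -> Xu x -> 0 < barrier (t, x).
Proof.
move=> sf t0 Xux; rewrite ltNge; apply/negP => B0.
have [psi [s [z [[psi0 solpsi] /andP[s0 st] Xz BE]]]] := barrier_attained x t0.
have psiz : psi s = z.
  by apply/eqP; rewrite -subr_eq0 -normr_le0 BE.
have sol : is_solution (neg_field H) z `[0, s]%classic (fun r => psi (s - r)).
  apply/is_solutionP; split; [by right; exists s; left|by rewrite subr0|].
  move=> T; rewrite /= in_itv/= => /andP[T0 Ts].
  have := sol_on_reflect s (solpsi s s0); rewrite subrr subr0.
  by apply: sol_on_sub.
apply: (sf _ _ _ Xz sol s); first by rewrite /= in_itv/= s0 lexx.
by rewrite subrr psi0.
Qed.

End barrier.

(** * From a barrier function to safety *)

Section barrier_implies_safe.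
Context {R : realType} {n : nat}.
Notation V := 'rV[R]_n.

Lemma abs_cont_graph_near (phi : R -> V) (b t : R) (A : set (R * V)) :
  abs_cont_on phi 0 b -> 0 <= t <= b -> open A -> A (t, phi t) ->
  exists2 d : R, 0 < d & forall u, 0 <= u <= b -> `|t - u| < d -> A (u, phi u).
Proof.
move=> ac /andP[t0 tb] oA At.
have /nbhs_ballP[r /= r0 rA] : nbhs (t, phi t) A by exact: open_nbhs_nbhs.
have [d d0 dP] := abs_cont_unif ac r0.
exists (Num.min r d); first by rewrite lt_min r0.
move=> u /andP[u0 ub]; rewrite lt_min => /andP[tur tud]; apply: rA.
split=> /=; first by rewrite -ball_normE.
rewrite -ball_normE/=; have [tu|/ltW ut] := leP t u.
  by rewrite distrC; apply: dP => //; move: tud; rewrite ltr_norml; lra.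
by apply: dP => //; move: tud; rewrite ltr_norml; lra.
Qed.

Lemma barrier_safe (F : V -> set V) (Xo Xu : set V) (B : R * V -> R) :
  barrier_candidate Xo Xu B -> lsc_on_Hplus B -> prop_star_star F B ->
  safe F Xo Xu.
Proof.
move=> [Bu Bo] lscB [U [[W [oW UE]] KU mono]] xo D phi Xxo.
move=> /is_solutionP[sD phi0 solphi] t1 Dt1 Xu1.
have t10 := sol_domain_ge0 sD Dt1.
have ac := (solphi _ Dt1).1.
pose S := [set t | 0 <= t <= t1 /\ B (t, phi t) <= 0].
have S0 : S 0 by split; [rewrite lexx|apply: Bo => //; rewrite phi0].
have ubS : has_ubound S by exists t1 => t [/andP[]].
have supS : has_sup S by split=> //; exists 0.
set tau := sup S.
have tau0 : 0 <= tau by exact: ub_le_sup.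
have taut1 : tau <= t1 by apply: sup_le_ub; [exists 0|move=> t [/andP[]]].
have tau01 : 0 <= tau <= t1 by rewrite tau0.
(* Lower semicontinuity makes the sublevel set closed, so the supremum is itself a time in it. *)
have Btau : B (tau, phi tau) <= 0.
  rewrite leNgt; apply/negP => Bpos.
  have [A [oA Atau AP]] := lscB (tau, phi tau) tau0 0 Bpos.
  have [d d0 dP] := abs_cont_graph_near ac tau01 oA Atau.
  have [t [/andP[t0 tt1] Bt] taut] := sup_adherent d0 supS.
  have St : S t by split=> //; rewrite t0.
  have ttau : t <= tau by exact: ub_le_sup.
  have At : A (t, phi t).
    apply: dP; first by rewrite t0.
    by rewrite ltr_norml; move: taut; rewrite -/tau; lra.
  by have := AP _ At t0; rewrite ltNge Bt.
have after t : tau < t -> t <= t1 -> 0 < B (t, phi t).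
  move=> taut tt1; rewrite ltNge; apply/negP => Bt.
  suff : t <= tau by rewrite leNgt taut.
  by apply: ub_le_sup => //; split=> //; rewrite (le_trans tau0 (ltW taut)).
have tault : tau < t1.
  rewrite lt_neqAle taut1 andbT; apply/eqP => taue.
  by have := Bu t1 _ t10 Xu1; rewrite ltNge -taue Btau.
have Wtau : W (tau, phi tau).
  have : U (tau, phi tau) by apply: KU; split.
  by rewrite UE => -[].
have [d d0 dP] := abs_cont_graph_near ac tau01 oW Wtau.
pose h := Num.min (d / 2) (t1 - tau).
have h0 : 0 < h by rewrite lt_min divr_gt0// subr_gt0.
have hd : h <= d / 2 by rewrite ge_min lexx.
have ht1 : tau + h <= t1 by rewrite -lerBrDl ge_min lexx orbT.
have sol_shift : is_solution F (phi tau) `[0, t1 - tau]%classic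
    (fun r => phi (tau + r)).
  apply/is_solutionP; split; [|by rewrite addr0|].
    by right; exists (t1 - tau); left; rewrite subr_ge0.
  move=> T; rewrite /= in_itv/= => /andP[T0 Tt1].
  have := sol_on_shift tau (sol_on_sub tau0 (lexx t1) (solphi _ Dt1)).
  by rewrite subrr; apply: sol_on_sub.
have not_in_K s : 0 < s -> s <= h -> ~ sublevel0 B (tau + s, phi (tau + s)).
  by move=> s0 sh [_ /=]; apply/negP; rewrite -ltNge; apply: after; lra.
have := mono tau _ _ _ tau0 sol_shift h.
move=> /(_ _ _ 0 h (lexx _) (ltW h0) (lexx _)).
rewrite addr0 => mono_h.
have := after (tau + h); rewrite ltrDl h0 ht1 => /(_ isT isT).
rewrite ltNge => /negP; apply; apply: le_trans (mono_h _ _) Btau.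
  by rewrite /= in_itv/= ltW//= lerBrDl.
move=> s /andP[s0 sh]; split.
  rewrite UE; split; last by rewrite /Hplus/= addr_ge0.
  apply: dP; first by lra.
  by rewrite ltr_norml; lra.
move=> [_ [A [oA As AK]]].
(* For [s > 0] the point is already outside [K]; at [s = 0] a neighborhood inside [K] would contain
   a slightly later point of the solution. *)
have [sE|sneq] := eqVneq s 0; last first.
  apply: (not_in_K s) => //; first by rewrite lt_neqAle eq_sym sneq.
  by apply: AK; split=> //; rewrite /Hplus/= addr_ge0.
move: As; rewrite sE addr0 => Atau.
have [d' d'0 d'P] := abs_cont_graph_near ac tau01 oA Atau.
pose h' := Num.min (d' / 2) h.
have h'0 : 0 < h' by rewrite lt_min divr_gt0.
have h'd : h' <= d' / 2 by rewrite ge_min lexx.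
have h'h : h' <= h by rewrite ge_min lexx orbT.
apply: (not_in_K h') => //; apply: AK; split; last first.
  by rewrite /Hplus/= addr_ge0// ltW.
by apply: d'P; [lra|rewrite ltr_norml; lra].
Qed.

End barrier_implies_safe.

(** * The equivalence *)

Theorem theorem2 (R : realType) (n : nat) (F : 'rV[R]_n -> set 'rV[R]_n)
  (Xo Xu : set 'rV[R]_n) :
  usc_setvalued F ->
  (forall x, compact (F x)) ->
  (forall x, convex_set (F x : set (convex_lmodType 'rV[R]_n))) ->
  backward_complete F ->
  closed Xo -> Xo `&` Xu = set0 ->
  (safe F Xo Xu <->
   exists B : R * 'rV[R]_n -> R,
     [/\ barrier_candidate Xo Xu B, lsc_on_Hplus B,
         (forall x, {within `[0, +oo[, continuous (fun t => B (t, x))})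
       & prop_star_star F B]).
Proof.
move=> uscF cptF cvxF bcF clXo _; split=> [sf|[B [cB lB _ sB]]]; last first.
  exact: barrier_safe cB lB sB.
have whole : rel_open (@Hplus R n).
  by exists setT; split; [exact: openT|rewrite setTI].
have [Xo0|/set0P/negP/negPn/eqP Xo0] := pselect (Xo !=set0); last first.
  (* With [Xo] empty there is no distance to minimize, and a positive constant is a barrier. *)
  exists (fun=> 1); split=> //.
  - by split=> // t x _; rewrite Xo0.
  - by move=> p _ a a1; exists setT; split=> //; exact: openT.
  - by move=> x; apply: continuous_subspaceT => t; exact: cvg_cst.
  - by exists (@Hplus R n); split=> // p [].
have uscH := usc_neg_field uscF.
have cptH x := compact_neg_field (cptF x).
have cvxH x := convex_neg_field (convex_setP (cvxF x)).
exists (barrier (neg_field F) Xo); split.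
- split=> t x t0 Xx; last exact: barrier_le0.
  by apply: (barrier_gt0 uscH cptH cvxH bcF clXo Xo0 (Xu := Xu)); rewrite ?neg_fieldK.
- exact: barrier_lsc.
- by move=> x; exact: barrier_continuous.
- exists (@Hplus R n); split=> // [p []//|].
  move=> t0 x0 D phi t00 sol S DS _ s1 s2 s10 s12 s2S.
  apply: (barrier_nonincreasing uscH cptH cvxH bcF clXo Xo0 (D := D) (x0 := x0)) => //.
    by rewrite neg_fieldK.
  have [sD _ _ _] := sol; apply: (sol_domain_down sD DS).
  by rewrite s2S (le_trans s10 s12).
Qed.
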